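(* Let $n\ge 3$ be odd, let $0<c<d$ be real numbers, let $E=[0,c]\cup[d,\infty)$, and let $\widetilde\gamma=\{\widetilde\gamma_t\}_{0\le t\le 3n}$ be a real sequence. The following are equivalent: (1) $\widetilde\gamma$ admits an $E$-representing measure. (2) $\widetilde\gamma$ admits an $E$-representing finitely atomic measure. (3) The four matrices $$\underline{H}_{3n-1}(\widetilde\gamma),\quad \underline{H}_{3n}^{[0,\infty)}(\widetilde\gamma),\quad \underline{H}_{3n-1}^{(-\infty,c]\cup[d,\infty)}(\widetilde\gamma),\quad \underline{H}_{3n}^{[0,c]\cup[d,\infty)}(\widetilde\gamma)\qquad(\ast)$$ are positive semidefinite, and one of the following holds: (a) All matrices in $(\ast)$ are positive definite. (b) Let $H$ be the first matrix in the list $(\ast)$ that fails to be positive definite. The sequence determined by $H$ is positively recursively generated, and, for the moment $\gamma_{3n+1}$ uniquely determined by it (see context) and $\widehat\gamma=(\widetilde\gamma_0,\dots,\widetilde\gamma_{3n},\gamma_{3n+1})$, the extended matrices $$\underline{H}_{3n+1}(\widehat\gamma),\quad \underline{H}_{3n+1}^{(-\infty,c]\cup[d,\infty)}(\widehat\gamma)$$ are positive semidefinite.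
   Context: An $E$-representing measure for $\widetilde\gamma$ is a positive Borel measure $\mu$ on $\mathbb{R}$ with $\operatorname{supp}\mu\subseteq E$ and $\widetilde\gamma_t=\int x^t\,d\mu$ for $0\le t\le 3n$. Hankel matrices: for a real sequence $\gamma=(\gamma_0,\gamma_1,\dots)$ (finite, long enough) put $H_m(\gamma)=(\gamma_{i+j})_{i,j=0}^m$. Define $\underline{H}_{2m}(\gamma)=H_m(\gamma)$; $\underline{H}_{2m+1}^{[0,\infty)}(\gamma)=(\gamma_{i+j+1})_{i,j=0}^{m}$; $\underline{H}_{2m}^{(-\infty,c]\cup[d,\infty)}(\gamma)=\bigl(cd\,\gamma_{i+j}-(c+d)\gamma_{i+j+1}+\gamma_{i+j+2}\bigr)_{i,j=0}^{m-1}$; $\underline{H}_{2m+1}^{[0,c]\cup[d,\infty)}(\gamma)=\bigl(cd\,\gamma_{i+j+1}-(c+d)\gamma_{i+j+2}+\gamma_{i+j+3}\bigr)_{i,j=0}^{m-1}$. (The lower index is the largest index of an entry of $\gamma$ occurring in the matrix.) Positively recursively generated: let $\delta=(\delta_0,\dots,\delta_{2k})$ be a real sequence with $H_k(\delta)\succeq0$. Its rank $r$ is $k+1$ if $H_k(\delta)$ is nonsingular and otherwise $r=\min\{i\ge0: H_i(\delta)\text{ is singular}\}$. $\delta$ is positively recursively generated if $H_{r-1}(\delta)\succ0$ and, with $(\varphi_0,\dots,\varphi_{r-1})^T:=H_{r-1}(\delta)^{-1}(\delta_r,\dots,\delta_{2r-1})^T$ (in the case $H_k(\delta)$ is singular),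 the recursion $\delta_j=\varphi_0\delta_{j-r}+\cdots+\varphi_{r-1}\delta_{j-1}$ holds for $j=r,\dots,2k$ (for $r=0$ this means $\delta=0$). Sequence determined by $H$ and the determined moment: the sequence $\delta=(\delta_0,\dots,\delta_{2k})$ determined by $H$ is the one with $H=H_k(\delta)$. If it is positively recursively generated (and $H$ singular), $\delta_{2k+1},\delta_{2k+2}$ are defined by the recursion $\delta_j=\varphi_0\delta_{j-r}+\cdots+\varphi_{r-1}\delta_{j-1}$ for $j=2k+1,2k+2$, where $r$ is the rank of $\delta$ and $(\varphi_0,\dots,\varphi_{r-1})^T=H_{r-1}(\delta)^{-1}(\delta_r,\dots,\delta_{2r-1})^T$ (for $r=0$ this means $\delta_{2k+1}=\delta_{2k+2}=0$). Concretely: if $H=\underline{H}_{3n-1}(\widetilde\gamma)$, then $\delta_t=\widetilde\gamma_t$ ($0\le t\le 3n-1$) and $\gamma_{3n+1}=\delta_{3n+1}$; if $H=\underline{H}_{3n}^{[0,\infty)}(\widetilde\gamma)$, then $\delta_t=\widetilde\gamma_{t+1}$ ($0\le t\le 3n-1$) and $\gamma_{3n+1}=\delta_{3n}$; if $H=\underline{H}_{3n-1}^{(-\infty,c]\cup[d,\infty)}(\widetilde\gamma)$, then $\delta_t=cd\,\widetilde\gamma_t-(c+d)\widetilde\gamma_{t+1}+\widetilde\gamma_{t+2}$ ($0\le t\le 3n-3$) and $\gamma_{3n+1}=\delta_{3n-1}+(c+d)\widetilde\gamma_{3n}-cd\,\widetilde\gamma_{3n-1}$; if $H=\underline{H}_{3n}^{[0,c]\cup[d,\infty)}(\widetilde\gamma)$,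 then $\delta_t=cd\,\widetilde\gamma_{t+1}-(c+d)\widetilde\gamma_{t+2}+\widetilde\gamma_{t+3}$ ($0\le t\le 3n-3$) and $\gamma_{3n+1}=\delta_{3n-2}+(c+d)\widetilde\gamma_{3n}-cd\,\widetilde\gamma_{3n-1}$. *)

(* Defs.v *)
From HB Require Import structures.
From mathcomp Require Import all_boot all_order all_algebra.
From mathcomp Require Import all_classical all_reals all_analysis.
Import Order.TTheory GRing.Theory Num.Theory.
Import numFieldNormedType.Exports.

Set Implicit Arguments.
Unset Strict Implicit.
Unset Printing Implicit Defensive.

Local Open Scope classical_set_scope.
Local Open Scope ring_scope.

Definition psdmx (R : realType) (m : nat) (A : 'M[R]_m) : Prop :=
  A \is symmetricmx /\ forall v : 'cV[R]_m, 0 <= (v^T *m A *m v) 0 0.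

Definition posdefmx (R : realType) (m : nat) (A : 'M[R]_m) : Prop :=
  A \is symmetricmx /\
  forall v : 'cV[R]_m, v != 0 -> 0 < (v^T *m A *m v) 0 0.

(* Finite real sequences are [seq R], read with default value 0; every entry
   used below lies within the sequence.
   [hankel_mx N s] is indexed by its size N, so it is H_{N-1}(s); it is the
   empty matrix for N = 0. *)
Definition hankel_mx (R : realType) (N : nat) (s : seq R) : 'M[R]_N :=
  \matrix_(i < N, j < N) s`_(i + j).

(* The argument N of the next four matrices is the lower index of the
   underlined H, i.e., the largest index of s occurring in the matrix:
   N = 2m for [uH] and [uH_gap], and N = 2m+1 for [uH_pos] and [uH_pos_gap];
   in all cases m = N./2. The "gap" is the interval ]c, d[. *)
Definition uH (R : realType) (N : nat) (s : seq R) : 'M[R]_((N./2).+1) :=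
  hankel_mx (N./2).+1 s.

Definition uH_pos (R : realType) (N : nat) (s : seq R) : 'M[R]_((N./2).+1) :=
  \matrix_(i, j) s`_(i + j + 1).

Definition uH_gap (R : realType) (c d : R) (N : nat) (s : seq R) :
    'M[R]_(N./2) :=
  \matrix_(i, j) (c * d * s`_(i + j) - (c + d) * s`_(i + j + 1)
                  + s`_(i + j + 2)).

Definition uH_pos_gap (R : realType) (c d : R) (N : nat) (s : seq R) :
    'M[R]_(N./2) :=
  \matrix_(i, j) (c * d * s`_(i + j + 1) - (c + d) * s`_(i + j + 2)
                  + s`_(i + j + 3)).

(* From here on delta = (delta_0, ..., delta_2k) has size 2k+1. *)

(* [iota 0 k.+1] starts at 0, so the position returned by [find] is the least
   i <= k with H_i(delta) singular. *)
Definition hrank (R : realType) (k : nat) (delta : seq R) : nat :=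
  if hankel_mx k.+1 delta \in unitmx then k.+1
  else find (fun i => hankel_mx i.+1 delta \notin unitmx) (iota 0 k.+1).

(* (phi_0, ..., phi_{r-1})^T for r = hrank k delta *)
Definition rec_coef (R : realType) (k : nat) (delta : seq R) :
    'cV[R]_(hrank k delta) :=
  invmx (hankel_mx (hrank k delta) delta) *m
    \col_(i < hrank k delta) delta`_(hrank k delta + i).

(* phi_0 s_{j-r} + ... + phi_{r-1} s_{j-1}, with phi and r coming from delta;
   it is an empty sum, hence 0, when r = 0 *)
Definition rec_val (R : realType) (k : nat) (delta s : seq R) (j : nat) : R :=
  \sum_(i < hrank k delta) rec_coef k delta i 0 * s`_(j - hrank k delta + i).

Definition pos_rec_gen (R : realType) (k : nat) (delta : seq R) : Prop :=
  [/\ psdmx (hankel_mx k.+1 delta),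
      posdefmx (hankel_mx (hrank k delta) delta) &
      hankel_mx k.+1 delta \notin unitmx ->
      forall j : nat, (hrank k delta <= j <= k.*2)%N ->
        delta`_j = rec_val k delta delta j].

Definition rec_step (R : realType) (k : nat) (delta s : seq R) : seq R :=
  rcons s (rec_val k delta s (size s)).

(* (delta_0, ..., delta_{2k+2}) *)
Definition rec_extend (R : realType) (k : nat) (delta : seq R) : seq R :=
  rec_step k delta (rec_step k delta delta).

Definition two_rays (R : realType) (c d : R) : set R :=
  `[0, c] `|` `[d, +oo[.

Definition measure_supp (R : realType)
    (mu : {measure set (measurableTypeR R) -> \bar R}) : set R :=
  [set x | forall U : set R, open U -> U x -> (0 < mu U)%E].

Definition representing_measure (R : realType) (E : set R) (N : nat)
    (g : seq R) (mu : {measure set (measurableTypeR R) -> \bar R}) : Prop :=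
  measure_supp mu `<=` E /\
  forall t : nat, (t <= N)%N ->
    mu.-integrable setT (fun x : R => (x ^+ t)%:E) /\
    (\int[mu]_x (x ^+ t)%:E = (g`_t)%:E)%E.

(* The zero measure is finitely atomic (m = 0). *)
Definition finitely_atomic (R : realType)
    (mu : {measure set (measurableTypeR R) -> \bar R}) : Prop :=
  exists (m : nat) (x rho : 'I_m -> R),
    (forall i, 0 < rho i) /\
    forall A : set (measurableTypeR R), measurable A ->
      mu A = (\sum_(i < m) (rho i)%:E * \d_(x i) A)%E.

(* The sequences determined by the four matrices. For n odd the first two have
   last index 3n-1 and the other two 3n-3. *)
Definition delta_H (R : realType) (n : nat) (g : seq R) : seq R :=
  mkseq (fun t => g`_t) (3 * n).

Definition delta_pos (R : realType) (n : nat) (g : seq R) : seq R :=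
  mkseq (fun t => g`_(t + 1)) (3 * n).

Definition delta_gap (R : realType) (c d : R) (n : nat) (g : seq R) : seq R :=
  mkseq (fun t => c * d * g`_t - (c + d) * g`_(t + 1) + g`_(t + 2))
    (3 * n - 2).

Definition delta_pos_gap (R : realType) (c d : R) (n : nat) (g : seq R) :
    seq R :=
  mkseq (fun t => c * d * g`_(t + 1) - (c + d) * g`_(t + 2) + g`_(t + 3))
    (3 * n - 2).

(* The sequence delta, of last index 2k, is positively recursively generated,
   and appending z as the moment of index 3n+1 to g gives positive
   semidefinite extended matrices. *)
Definition extension_cond (R : realType) (c d : R) (n : nat) (g : seq R)
    (k : nat) (delta : seq R) (z : R) : Prop :=
  [/\ pos_rec_gen k delta,
      psdmx (uH (3 * n + 1) (rcons g z)) &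
      psdmx (uH_gap c d (3 * n + 1) (rcons g z))].

(* Main.v *)
(** Write L for the moment functional p |-> sum_i p_i gamma_i on polynomials and
    f = (X - c)(X - d); the four matrices are the Gram matrices of
    p |-> L(w p^2) for w = 1, X, f, Xf.

    If one of them is not positive definite, a representing measure has
    L(w p^2) <= 0 for some p <> 0, hence w p^2 = 0 almost everywhere and the
    measure is carried by the finitely many roots of w p^2.  The weighted
    measures w mu are then finitely atomic, the rank of their Hankel matrices is
    the number of atoms, and the recursion coefficients are those of the
    polynomial vanishing at the atoms; so the recursion returns true moments of
    mu.

    Conversely, let 2m = 3n+1.  In case (b) the extended matrices for w = 1 and
    w = f are positive semidefinite by assumption; if both are positive definite,
    or in case (a), the moment of index 2m can be chosen minimal, so that at
    least one of them becomes singular.  A kernel polynomial q of least degree r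
    is orthogonal to all lower degrees, hence has r distinct real roots, and
    interpolation at the roots of q (for w = 1) or of f q (for w = f) is a
    quadrature formula exact up to degree 2m-1.  Positivity of the four forms on
    Lagrange polynomials makes the weights nonnegative and puts the nodes in
    [0,c] u [d,oo).  When r < m the formula may miss the moment of index 2m,
    which is not prescribed, so flatness of the extension is not needed. *)

Require Import Defs.
From HB Require Import structures.
From mathcomp Require Import all_boot all_order all_algebra.
From mathcomp Require Import ring lra zify.
From mathcomp Require complex polyrcf.
From mathcomp Require Import all_classical all_reals all_analysis.
From mathcomp Require Import measurable_realfun.
Import Order.TTheory GRing.Theory Num.Theory.
Import numFieldNormedType.Exports.

Set Implicit Arguments.
Unset Strict Implicit.
Unset Printing Implicit Defensive.

Local Open Scope classical_set_scope.
Local Open Scope ring_scope.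

Definition psize (R : rcfType) (p : {poly R}) : nat := size p.

(* Depending on the lemma a size comes from, the coefficient structure inside
   [size p] is written along different inheritance paths, which [lia] reads as
   distinct atoms; [psize] merges them. *)
Ltac size_lia :=
  repeat match goal with
  | H : context [@size ?A (@polyseq ?T ?p)] |- _ =>
      change (@size A (@polyseq T p)) with (psize p) in H
  | |- context [@size ?A (@polyseq ?T ?p)] =>
      change (@size A (@polyseq T p)) with (psize p)
  end; lia.

(** * Moment functionals *)

Section Riesz.
Variable R : rcfType.
Implicit Types (s : nat -> R) (p q w : {poly R}).

(** The moment functional L of the sequence s. Sequences are total functions here, and statements
    about finitely many moments bound the size of the polynomial instead. *)
Definition riesz s p : R := \sum_(i < size p) p`_i * s i.

Lemma rieszE s p N : (size p <= N)%N -> riesz s p = \sum_(i < N) p`_i * s i.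
Proof.
move=> hN; rewrite /riesz (big_ord_widen _ (fun i => p`_i * s i) hN).
rewrite big_mkcond; apply: eq_bigr => i _; case: ltnP => // hi.
by rewrite nth_default // mul0r.
Qed.

Fact riesz_is_scalar s : scalar (riesz s).
Proof.
move=> a p q; pose N := maxn (size p) (size q).
have hp : (size p <= N)%N by rewrite leq_maxl.
have hq : (size q <= N)%N by rewrite leq_maxr.
have hpq : (size (a *: p + q)%R <= N)%N.
  by rewrite (leq_trans (size_polyD _ _)) // geq_max hq (leq_trans (size_scale_leq _ _)).
rewrite !(@rieszE s _ N) // mulr_sumr -big_split /=.
by apply: eq_bigr => i _; rewrite coefD coefZ mulrDl mulrA.
Qed.

HB.instance Definition _ s := GRing.isLinear.Build R {poly R} R *%R (riesz s)
  (riesz_is_scalar s).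

Lemma rieszXn s n : riesz s 'X^n = s n.
Proof.
rewrite (@rieszE s _ n.+1) ?size_polyXn // big_ord_recr /= coefXn eqxx mul1r.
rewrite big1 ?add0r // => i _; rewrite coefXn.
by rewrite ltn_eqF ?mul0r.
Qed.

Lemma riesz_atoms s (xs : seq R) (rho : R -> R) N p :
  (forall t, (t < N)%N -> s t = \sum_(x <- xs) rho x * x ^+ t) ->
  (size p <= N)%N -> riesz s p = \sum_(x <- xs) rho x * p.[x].
Proof.
move=> hs hp; under [RHS]eq_bigr do rewrite horner_coef mulr_sumr.
rewrite exchange_big; apply: eq_bigr => i _.
rewrite hs ?mulr_sumr; last exact: leq_trans hp.
by apply: eq_bigr => x _; rewrite mulrCA.
Qed.

(** Moments of p |-> L(w p), hence of w mu when s has representing measure mu. The localizing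
    matrices become ordinary Hankel matrices of this sequence. *)
Definition wseq w s : nat -> R := fun t => riesz s (w * 'X^t).

Lemma riesz_wseq w s p : riesz (wseq w s) p = riesz s (w * p).
Proof.
rewrite {1}/riesz; under eq_bigr do rewrite -linearZ /= scalerAr.
by rewrite -linear_sum -mulr_sumr -poly_def coefK.
Qed.

(** Basis-free semidefiniteness of the Hankel matrix of size N: p ranges over degrees below N. *)
Definition sq_ge0 s N := forall p, (size p <= N)%N -> 0 <= riesz s (p ^+ 2).

Definition sq_gt0 s N :=
  forall p, p != 0 -> (size p <= N)%N -> 0 < riesz s (p ^+ 2).

Lemma sq_gt0_ge0 s N : sq_gt0 s N -> sq_ge0 s N.
Proof.
move=> h p hp; have [->|/h/(_ hp)/ltW//] := eqVneq p 0.
by rewrite expr0n linear0.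
Qed.

Lemma riesz_sqDZ s p q a :
  riesz s ((q + a *: p) ^+ 2) =
  riesz s (q ^+ 2) + 2 * a * riesz s (p * q) + a ^+ 2 * riesz s (p ^+ 2).
Proof.
rewrite sqrrD -scalerAr exprZn mulr2n !linearD !linearZ /= (mulrC q p).
by ring.
Qed.

(** If L(p^2) = 0, then a |-> L((q + a p)^2) is affine; being bounded below, it has slope 0. *)
Lemma riesz_sq_kernel s N p q : sq_ge0 s N -> (size p <= N)%N ->
  (size q <= N)%N -> riesz s (p ^+ 2) = 0 -> riesz s (p * q) = 0.
Proof.
move=> h hp hq p0; apply/eqP/negPn/negP => n0.
set b := riesz s (p * q) in n0.
(* This choice makes L((q + a p)^2) equal to -1. *)
pose a := - (riesz s (q ^+ 2) + 1) / (2 * b).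
have /h : (size (q + a *: p)%R <= N)%N.
  by rewrite (leq_trans (size_polyD _ _)) // geq_max hq (leq_trans (size_scale_leq _ _)).
rewrite riesz_sqDZ p0 mulr0 addr0 -/b.
have -> : 2 * a * b = - (riesz s (q ^+ 2) + 1) by rewrite /a; field.
lra.
Qed.

Lemma sq_gt0_not s N : sq_ge0 s N -> ~ sq_gt0 s N ->
  exists p, [/\ p != 0, (size p <= N)%N & riesz s (p ^+ 2) = 0].
Proof.
move=> h /existsNP[p] /not_implyP[p0] /not_implyP[hp].
move=> hn; exists p; split=> //; apply/eqP; rewrite eq_le h // andbT leNgt.
exact/negP.
Qed.
End Riesz.

(** * Interpolatory quadrature *)

Section Quadrature.
Variable R : rcfType.
Implicit Types (s : nat -> R) (p q w : {poly R}) (xs : seq R).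

Definition nodal xs : {poly R} := \prod_(x <- xs) ('X - x%:P).

(** Lagrange basis polynomial of the node x, for xs without repetitions. *)
Definition lagr xs x : {poly R} :=
  (nodal (rem x xs)).[x]^-1 *: nodal (rem x xs).

Lemma nodal_monic xs : nodal xs \is monic.
Proof. exact: monic_prod_XsubC. Qed.

Lemma size_nodal xs : size (nodal xs) = (size xs).+1.
Proof. by rewrite size_prod_XsubC. Qed.

Lemma nodal_neq0 xs : nodal xs != 0.
Proof. by rewrite monic_neq0 ?nodal_monic. Qed.

Lemma root_nodal xs x : root (nodal xs) x = (x \in xs).
Proof. exact: root_prod_XsubC. Qed.

Lemma horner_nodal_eq0 xs x : ((nodal xs).[x] == 0) = (x \in xs).
Proof. by rewrite -root_nodal. Qed.

Lemma dvdp_nodal xs p : uniq xs -> all (root p) xs -> nodal xs %| p.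
Proof. by move=> u h; apply: uniq_roots_dvdp => //; rewrite uniq_rootsE. Qed.

Lemma lagr_self xs x : uniq xs -> (lagr xs x).[x] = 1.
Proof. by move=> u; rewrite hornerZ mulVf // horner_nodal_eq0 mem_rem_uniqF. Qed.

Lemma lagr_other xs x y : y \in xs -> y != x -> (lagr xs x).[y] = 0.
Proof.
move=> hy yx; rewrite hornerZ; apply/eqP; rewrite mulf_eq0 horner_nodal_eq0.
have [hx|hx] := boolP (x \in xs); last by rewrite rem_id ?hy ?orbT.
by have := perm_mem (perm_to_rem hx) y; rewrite hy inE (negPf yx) /= => <-; rewrite orbT.
Qed.

Lemma lagr_neq0 xs x : uniq xs -> lagr xs x != 0.
Proof.
move=> u; apply/eqP => /(congr1 (horner^~ x)); rewrite lagr_self // horner0.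
exact/eqP/oner_neq0.
Qed.

Lemma size_lagr xs x : x \in xs -> (size (lagr xs x) <= size xs)%N.
Proof.
move=> hx; rewrite (leq_trans (size_scale_leq _ _)) // size_nodal size_rem //.
by case: xs hx.
Qed.

(** The difference of p and its Lagrange interpolant [l] vanishes at the nodes, so it is a multiple
    of [nodal xs], on which L vanishes. The bound N may exceed the number of nodes. *)
Lemma quadrature s xs N : uniq xs -> (size xs <= N)%N ->
  (forall h, (size (nodal xs * h)%R <= N)%N -> riesz s (nodal xs * h) = 0) ->
  forall p, (size p <= N)%N ->
    riesz s p = \sum_(x <- xs) riesz s (lagr xs x) * p.[x].
Proof.
move=> u hN hs p hp.
pose l := \sum_(x <- xs) p.[x] *: lagr xs x.
have sl : (size l <= N)%N.
  apply: leq_trans (hN); rewrite /l big_seq_cond.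
  apply: (big_ind (fun l : {poly R} => size l <= size xs)%N).
  - by rewrite size_poly0.
  - by move=> ? ? h1 h2; rewrite (leq_trans (size_polyD _ _)) // geq_max h1.
  - move=> x /andP[hx _]; rewrite (leq_trans (size_scale_leq _ _)) //.
    exact: size_lagr.
have /dvdpP[h hE] : nodal xs %| p - l.
  apply: dvdp_nodal => //; apply/allP => x hx; rewrite /root hornerD hornerN.
  rewrite /l horner_sum (bigD1_seq x) //= hornerZ lagr_self // mulr1.
  rewrite big_seq_cond big1 ?addr0 ?subrr // => y /andP[hy yx].
  by rewrite hornerZ lagr_other ?mulr0 // eq_sym.
have : riesz s (p - l) = 0.
  rewrite hE mulrC hs // mulrC -hE (leq_trans (size_polyD _ _)) //.
  by rewrite size_polyN geq_max hp.
rewrite linearB /= => /eqP; rewrite subr_eq0 => /eqP ->; rewrite /l linear_sum.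
by apply: eq_bigr => x _; rewrite linearZ /= mulrC.
Qed.

End Quadrature.

(** * Real-rooted polynomials *)

Section RealRooted.
Variable R : rcfType.
Implicit Types p q : {poly R}.
Import complex.

(** Over R[i] there is a root a + ib. The remainder of q modulo (X - a)^2 + b^2 is linear and
    vanishes at a + ib, so it is 0 once b <> 0. *)
Lemma quadratic_factor q : (1 < size q)%N -> (forall x, ~~ root q x) ->
  exists a b : R, ('X - a%:P) ^+ 2 + (b ^+ 2)%:P %| q.
Proof.
move=> sq nr; have : size (map_poly (real_complex R) q) != 1%N.
  by rewrite size_map_poly neq_ltn sq orbT.
case/closed_rootP => -[a b] hz; exists a, b.
set D := _ + _.
have [e eE] : exists e, e = a ^+ 2 + b ^+ 2 by exists (a ^+ 2 + b ^+ 2).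
have DE : D = 'X^2 + (- (2 * a) *: 'X + e%:P).
  rewrite eE /D sqrrD -mul_polyC !rmorphN !rmorphM !rmorphD /= !rmorphXn.
  by ring.
clearbody D; have sD : size D = 3%N.
  rewrite DE size_polyDl size_polyXn // (leq_ltn_trans (size_polyD _ _)) //.
  by rewrite gtn_max (leq_ltn_trans (size_scale_leq _ _)) ?size_polyX //
    (leq_ltn_trans (size_polyC_leq1 _)).
have D0 : D != 0 by rewrite -size_poly_gt0 sD.
have rD : root (map_poly (real_complex R) D) (Complex a b).
  rewrite /root DE !rmorphD /= map_polyXn map_polyZ map_polyX map_polyC /=.
  rewrite !hornerE /= /real_complex_def; simpc.
  by rewrite eq_complex /= eE; apply/andP; split; apply/eqP; ring.
have hm : root (map_poly (real_complex R) (q %% D)) (Complex a b).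
  move: hz; rewrite [in X in X -> _](divp_eq q D) rmorphD rmorphM /= rootE hornerD hornerM.
  by rewrite (eqP rD) mulr0 add0r.
have sm : (size (q %% D)%R <= 2)%N by rewrite -ltnS -sD ltn_modp.
set m := (q %% D)%R in hm sm.
have [u [v mE]] : exists u v, m = u *: 'X + v%:P.
  exists m`_1, m`_0; apply/polyP => -[|[|i]];
    rewrite coefD coefZ coefX coefC /= ?mulr0 ?mulr1 ?add0r ?addr0 //.
  by rewrite nth_default // (leq_trans sm).
move: hm; rewrite /root mE rmorphD /= map_polyZ map_polyX map_polyC /=.
rewrite !hornerE /= /real_complex_def; simpc.
rewrite eq_complex /= => /andP[/eqP h0 /eqP h1].
(* The imaginary part gives u b = 0, and b = 0 would make a a real root of q. *)
have u0 : u = 0.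
  have [b0|b0] := eqVneq b 0; last by apply: (mulIf b0); rewrite mul0r -[RHS]h1; ring.
  case/negP: (nr a); rewrite -(fmorph_root (real_complex R)).
  by rewrite b0 in hz.
have v0 : v = 0 by rewrite -[RHS]h0 u0; ring.
by rewrite /dvdp -/m mE u0 v0 scale0r polyC0 addr0.
Qed.

(** The hypothesis excludes conjugate pairs of roots and, with b = 0, double roots; linear factors
    are split off by induction on the size. *)
Lemma real_rooted q : q \is monic ->
  (forall a b p, q <> (('X - a%:P) ^+ 2 + (b ^+ 2)%:P) * p) ->
  exists2 xs, uniq xs & q = nodal xs.
Proof.
have [N] := ubnP (size q); elim: N q => // N IH q sq mq hq.
have [q1|q1] := leqP (size q) 1.
  exists [::] => //; rewrite /nodal big_nil.
  have [c qc] : exists c, q = c%:P by exists q`_0; apply: size1_polyC.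
  by move: mq; rewrite qc monicE lead_coefC => /eqP ->.
have [[a ra]|nr] := EM (exists a, root q a); last first.
  have [|a [b]] := quadratic_factor q1.
    by move=> x; apply/negP => rx; apply: nr; exists x.
  by case/dvdpP => p; rewrite mulrC => /hq.
have [p qE] := factor_theorem _ _ ra; rewrite mulrC in qE.
have mp : p \is monic by move: mq; rewrite qE monicMl ?monicXsubC.
have [||xs u pE] := IH p _ mp.
- move: sq; rewrite qE size_monicM ?monicXsubC ?monic_neq0 // size_XsubC.
  by rewrite addSn.
- move=> a' b p' e; apply: (hq a' b (('X - a%:P) * p')).
  by rewrite qE e mulrCA.
exists (a :: xs); last by rewrite qE pE /nodal big_cons.
rewrite /= u andbT -root_nodal -pE; apply/negP => rpa.
have [p' pE'] := factor_theorem _ _ rpa.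
by apply: (hq a 0 p'); rewrite qE pE' expr0n polyC0; ring.
Qed.
End RealRooted.

(** * Gauss quadrature *)

Section Gauss.
Variable R : rcfType.
Implicit Types (s : nat -> R) (p q w h : {poly R}) (xs : seq R).

(* The nodes are the roots of a kernel polynomial q of least degree r.  If
   r + i < m then X^i q is again in the kernel, which is where exactness up to
   degree 2m-1, and not only m+r, comes from.  A factor (X - a)^2 + b^2 of
   q = ((X - a)^2 + b^2) h is impossible, since L(q h) = 0 would be
   L(((X - a) h)^2) + b^2 L(h^2) > 0; b = 0 excludes double roots. *)
Lemma gauss_nodes s m : sq_ge0 s m.+1 -> ~ sq_gt0 s m.+1 ->
  exists xs, [/\ uniq xs, (size xs <= m)%N, sq_gt0 s (size xs) &
    forall h, (size (nodal xs * h)%R <= maxn m.*2 (size xs).*2.+1)%N ->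
      riesz s (nodal xs * h) = 0].
Proof.
move=> s0 /(sq_gt0_not s0) [p0 [p0n0 sp0 p0E]].
pose P r := exists p, [/\ p != 0, size p = r.+1 & riesz s (p ^+ 2) = 0].
have exP : exists r, asbool (P r).
  exists (size p0).-1; apply/asboolP; exists p0.
  by rewrite prednK ?size_poly_gt0.
case: (ex_minnP exP) => r /asboolP[p [pn0 sp pE]] minr.
have rm : (r <= m)%N.
  rewrite -ltnS (leq_trans _ sp0) // -ltnS; apply: (@leq_ltn_trans (size p0).-1.+1).
    rewrite ltnS minr //; apply/asboolP; exists p0.
    by rewrite prednK ?size_poly_gt0.
  by rewrite prednK ?size_poly_gt0.
pose q := (lead_coef p)^-1 *: p.
have mq : q \is monic by rewrite monicE lead_coefZ mulVf ?lead_coef_eq0.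
have sq : size q = r.+1 by rewrite size_scale // invr_eq0 lead_coef_eq0.
have qE : riesz s (q ^+ 2) = 0 by rewrite exprZn linearZ /= pE mulr0.
(* By minimality of r no nonzero polynomial of lower degree has a null square. *)
have pos : sq_gt0 s r.
  move=> h hn0 sh; rewrite lt_def s0 ?andbT; last by lia.
  apply/eqP => hE; have : (r <= (size h).-1)%N.
    by rewrite minr //; apply/asboolP; exists h; rewrite prednK ?size_poly_gt0.
  by move: hn0; rewrite -size_poly_gt0; lia.
have sX i : size (q * 'X^i) = (i + r.+1)%N.
  by rewrite size_Mmonic ?monic_neq0 ?monicXn // size_polyXn sq; lia.
have qX i : (i + r < m)%N -> riesz s ((q * 'X^i) ^+ 2) = 0.
  elim: i => [|i IH] him; first by rewrite expr0 mulr1.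
  (* One factor X moves across the square, leaving the kernel element X^i q as a factor. *)
  have -> : (q * 'X^(i.+1)) ^+ 2 = (q * 'X^i) * (q * 'X^(i.+2)).
    by rewrite !exprS; ring.
  by apply: (riesz_sq_kernel s0) (IH _); rewrite ?sX; lia.
(* Up to j = m the kernel element is q itself; beyond, it is X^(j-m) q, tested against X^m. The
   bound 2r + 1 exceeds 2m only for r = m, and then j <= m. *)
have qXn j : (j + r < maxn m.*2 r.*2.+1)%N -> riesz s (q * 'X^j) = 0.
  move=> hj; have [jm|jm] := leqP j m.
    by apply: (riesz_sq_kernel s0) qE; rewrite ?sq ?size_polyXn //; lia.
  have -> : q * 'X^j = (q * 'X^(j - m)) * 'X^m.
    by rewrite -mulrA -exprD subnK // ltnW.
  by apply: (riesz_sq_kernel s0) (qX _ _); rewrite ?sX ?size_polyXn //; lia.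
have orth h : (size (q * h)%R <= maxn m.*2 r.*2.+1)%N -> riesz s (q * h) = 0.
  have [->|hn0] := eqVneq h 0; first by rewrite mulr0 linear0.
  rewrite size_monicM // sq => sh.
  rewrite -[h]coefK poly_def mulr_sumr linear_sum big1 // => i _.
  rewrite -scalerAr linearZ /= qXn ?mulr0 //; apply: leq_trans sh.
  by rewrite addSn /= addnC ltn_add2l.
have [|xs u qxs] := real_rooted mq.
  move=> a b h qh.
  have hn0 : h != 0 by apply/eqP => h0; move: (monic_neq0 mq); rewrite qh h0 mulr0 eqxx.
  have sh : (size h).+2 = r.+1.
    rewrite -sq qh size_monicM //; last first.
      apply/monicP; rewrite lead_coefDl; last first.
        by rewrite size_exp_XsubC (leq_ltn_trans (size_polyC_leq1 _)).
      by apply/eqP; rewrite -monicE monic_exp ?monicXsubC.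
    by rewrite size_polyDl size_exp_XsubC // (leq_ltn_trans (size_polyC_leq1 _)).
  have : riesz s (q * h) = 0 by apply: orth; rewrite size_monicM // sq; size_lia.
  have -> : q * h = (('X - a%:P) * h) ^+ 2 + (b ^+ 2) *: h ^+ 2.
    by rewrite qh -mul_polyC; ring.
  rewrite linearD linearZ /=.
  have h1 : 0 < riesz s ((('X - a%:P) * h) ^+ 2).
    apply: pos; first by rewrite mulf_neq0 ?polyXsubC_eq0.
    by rewrite size_monicM ?monicXsubC // size_XsubC; lia.
  have h2 : 0 <= b ^+ 2 * riesz s (h ^+ 2).
    by rewrite mulr_ge0 ?sqr_ge0 // ltW // pos //; lia.
  by move=> h3; move: h1; lra.
have xr : size xs = r by apply/eqP; rewrite -eqSS -size_nodal -qxs sq.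
by exists xs; split; rewrite ?xr // -qxs.
Qed.

(** Applied to a weight times the square of a Lagrange polynomial, this turns positivity of a form
    into the sign of a quadrature weight or of the weight polynomial at a node. *)
Lemma riesz_peak s xs (rho : R -> R) N p x :
  (forall h, (size h <= N)%N -> riesz s h = \sum_(y <- xs) rho y * h.[y]) ->
  uniq xs -> x \in xs -> (forall y, y \in xs -> y != x -> p.[y] = 0) ->
  (size p <= N)%N -> riesz s p = rho x * p.[x].
Proof.
move=> H u hx hp sp; rewrite H // (bigD1_seq x) //= big_seq_cond big1 ?addr0 //.
by move=> y /andP[hy yx]; rewrite hp ?mulr0.
Qed.

Lemma size_sqr_leq p n : (size p <= n)%N -> (size (p ^+ 2)%R <= n.*2.-1)%N.
Proof.
move=> h; rewrite expr2 (leq_trans (size_polyMleq _ _)) //.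
by move: h; move: (size p) => k; lia.
Qed.

Lemma size_mul_sqr_leq w p n k : (size w <= k)%N -> (size p <= n)%N ->
  (size (w * p ^+ 2)%R <= (k + n.*2.-1).-1)%N.
Proof.
move=> hw hp; rewrite (leq_trans (size_polyMleq _ _)) //.
by have := size_sqr_leq hp; move: hw; lia.
Qed.

(** * Atoms on the two rays *)

Definition gap_poly (c d : R) : {poly R} := ('X - c%:P) * ('X - d%:P).

Lemma size_gap_poly c d : size (gap_poly c d) = 3%N.
Proof. by rewrite size_monicM ?monicXsubC ?polyXsubC_eq0 // !size_XsubC. Qed.

Lemma gap_poly_monic c d : gap_poly c d \is monic.
Proof. by rewrite monicMl monicXsubC. Qed.

Lemma horner_gap_poly c d x : (gap_poly c d).[x] = (x - c) * (x - d).
Proof. by rewrite !hornerE. Qed.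

(** The two rays are written as x >= 0 and (x - c)(x - d) >= 0, the signs that the weights X and f
    detect. N counts moments, and zero masses are allowed. *)
Definition rays_atoms (c d : R) s N xs (rho : R -> R) :=
  [/\ uniq xs, forall x, x \in xs -> 0 <= x /\ 0 <= (x - c) * (x - d),
      forall x, x \in xs -> 0 <= rho x &
      forall t, (t < N)%N -> s t = \sum_(x <- xs) rho x * x ^+ t].

Section Rays.
Variables (c d : R) (s : nat -> R) (m : nat).
Hypotheses (c0 : 0 < c) (cd : c < d) (m0 : (0 < m)%N).
Let f := gap_poly c d.
Hypotheses (sq_id : sq_ge0 s m.+1) (sq_X : sq_ge0 (wseq 'X s) m)
  (sq_gap : sq_ge0 (wseq f s) m) (sq_Xgap : sq_ge0 (wseq ('X * f) s) m.-1).

(** With l_x the Lagrange polynomials of the Gauss nodes, L(l_x^2), L(X l_x^2) and L(f l_x^2) are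
    rho(x) times 1, x and f(x); the first is positive and the others are nonnegative. *)
Lemma rays_atoms_hankel_singular : ~ sq_gt0 s m.+1 ->
  exists xs rho, rays_atoms c d s m.*2 xs rho.
Proof.
case/(gauss_nodes sq_id) => xs [u xm pos orth].
set N := maxn _ _ in orth.
have xN : (size xs <= N)%N by rewrite /N; size_lia.
have exact := quadrature u xN orth.
pose rho x := riesz s (lagr xs x); exists xs, rho.
have peak x w n : x \in xs -> (size w <= n)%N -> ((n + (size xs).*2.-1).-1 <= N)%N ->
    riesz s (w * lagr xs x ^+ 2) = rho x * w.[x].
  move=> hx sw hn; rewrite (riesz_peak exact u hx).
  - by rewrite hornerM horner_exp lagr_self // expr1n mulr1.
  - by move=> y hy yx; rewrite hornerM horner_exp lagr_other // expr0n mulr0.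
  - by apply: leq_trans hn; apply: size_mul_sqr_leq => //; apply: size_lagr.
have rho0 x : x \in xs -> 0 < rho x.
  move=> hx; have := @peak x 1 1%N hx; rewrite size_poly1 hornerC mulr1 mul1r.
  rewrite /N => <- //; last by lia.
  by rewrite pos ?lagr_neq0 ?size_lagr.
have xs0 x : x \in xs -> (0 < size xs)%N by case: (xs).
split=> // [x hx|x hx|t ht]; last 1 first.
- rewrite -rieszXn exact ?size_polyXn; last by rewrite /N; size_lia.
  by apply: eq_bigr => y _; rewrite hornerXn.
- split; rewrite -(pmulr_rge0 _ (rho0 _ hx)).
    rewrite -[X in _ * X]hornerX -(@peak x 'X 2%N) ?size_polyX //; last first.
      by have := xs0 _ hx; rewrite /N; size_lia.
    by rewrite -riesz_wseq sq_X // (leq_trans (size_lagr hx)).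
  (* For r nodes, f l_x^2 has size at most 2r + 1, which the second argument of the maximum N
     covers. *)
  rewrite -horner_gap_poly -(@peak x _ 3%N) ?size_gap_poly //; last first.
    by have := xs0 _ hx; rewrite /N; size_lia.
  by rewrite -riesz_wseq sq_gap // (leq_trans (size_lagr hx)).
- exact/ltW/rho0.
Qed.

(** The nodes are c, d and the Gauss nodes of p |-> L(f p). The weights are L(l^2) > 0 for the
    Lagrange polynomials l of all nodes. For the location, l_x is taken on the Gauss nodes alone in
    L(f l_x^2) and L(X f l_x^2), since f already vanishes at c and d. *)
Lemma rays_atoms_gap_singular : sq_gt0 s m.+1 -> ~ sq_gt0 (wseq f s) m ->
  exists xs rho, rays_atoms c d s m.*2 xs rho.
Proof.
move=> spos; have := sq_gap; rewrite -(prednK m0).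
move=> /gauss_nodes gn /gn [xs [u xm pos orth]].
set N := maxn _ _ in orth.
(* If q = (X - c) p were the kernel polynomial of the weighted functional, then
   L((f p)^2) = L(f q (X - d) p) = 0, against [spos]; likewise for d. *)
have fN x : x = c \/ x = d -> x \notin xs.
  move=> xcd; apply/negP; rewrite -root_nodal.
  case/factor_theorem => p pE.
  (* The other root of f. *)
  pose y := c + d - x.
  have fE : f = ('X - x%:P) * ('X - y%:P).
    rewrite /f /gap_poly /y; case: xcd => ->.
      by rewrite addrAC subrr add0r.
    by rewrite addrK mulrC.
  have pn0 : p != 0.
    by apply/eqP => p0; move: (nodal_neq0 xs); rewrite pE p0 mul0r eqxx.
  have sp : size p = size xs.
    by apply/eqP; rewrite -eqSS -size_nodal pE size_Mmonic ?monicXsubC // size_XsubC; size_lia.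
  have : 0 < riesz s ((f * p) ^+ 2).
    apply: spos; first by rewrite mulf_neq0 // monic_neq0 ?gap_poly_monic.
    by rewrite size_monicM ?gap_poly_monic // size_gap_poly sp; size_lia.
  suff -> : riesz s ((f * p) ^+ 2) = 0 by rewrite ltxx.
  have -> : (f * p) ^+ 2 = f * (nodal xs * (('X - y%:P) * p)).
    by rewrite pE fE; ring.
  rewrite -riesz_wseq orth // size_monicM ?nodal_monic // ?mulf_neq0 ?polyXsubC_eq0 //.
  by rewrite size_nodal size_monicM ?monicXsubC // size_XsubC sp /N; size_lia.
have uX : uniq [:: c, d & xs].
  by rewrite /= inE negb_or lt_eqF // !fN /=; auto.
have nE : nodal [:: c, d & xs] = f * nodal xs.
  by rewrite /nodal !big_cons mulrA.
have xN : (size [:: c, d & xs] <= N.+2)%N by rewrite /= /N; size_lia.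
(* The factor f raises the degree of exactness by two. *)
have exact : forall p, (size p <= N.+2)%N ->
    riesz s p = \sum_(x <- [:: c, d & xs]) riesz s (lagr [:: c, d & xs] x) * p.[x].
  apply: quadrature => // h; rewrite nE -mulrA => hN.
  rewrite -riesz_wseq orth //; have [->|hn0] := eqVneq h 0.
    by rewrite mulr0 size_poly0.
  move: hN; rewrite size_monicM ?gap_poly_monic ?mulf_neq0 ?nodal_neq0 //.
  by rewrite size_gap_poly; size_lia.
set xs' := [:: c, d & xs] in uX nE xN exact *.
pose rho x := riesz s (lagr xs' x); exists xs', rho.
have rho0 x : x \in xs' -> 0 < rho x.
  move=> hx; have : riesz s (lagr xs' x ^+ 2) = rho x.
    rewrite (riesz_peak exact uX hx).
    - by rewrite horner_exp lagr_self // expr1n mulr1.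
    - by move=> y hy yx; rewrite horner_exp lagr_other // expr0n.
    - by have := size_sqr_leq (size_lagr hx); rewrite /= /N; size_lia.
  move=> <-; apply: spos; first by rewrite lagr_neq0.
  by apply: leq_trans (size_lagr hx) _; rewrite /=; size_lia.
have peak x w n : x \in xs -> (size w <= n)%N ->
    ((n + (size xs).*2.+1).-1 <= N.+2)%N ->
    riesz s (w * f * lagr xs x ^+ 2) = rho x * (w.[x] * ((x - c) * (x - d))).
  move=> hx sw hn; rewrite (@riesz_peak _ _ rho _ _ x exact uX) ?inE ?hx ?orbT //.
  - by rewrite hornerM [(w * f).[_]]hornerM horner_gap_poly horner_exp lagr_self // expr1n mulr1.
  - move=> y; rewrite !inE => /or3P[/eqP->|/eqP->|hy] yx; rewrite hornerM [(w * f).[_]]hornerM.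
    + by rewrite horner_gap_poly subrr mul0r mulr0 mul0r.
    + by rewrite horner_gap_poly subrr !mulr0 mul0r.
    + by rewrite horner_exp lagr_other // expr0n mulr0.
  - apply: leq_trans hn; have sl := size_lagr hx.
    have -> : ((n + (size xs).*2.+1).-1 = (n.+2 + (size xs).*2.-1).-1)%N.
      by move: hx; case: (xs) => //= *; size_lia.
    apply: size_mul_sqr_leq sl; rewrite (leq_trans (size_polyMleq _ _)) //.
    by rewrite size_gap_poly; move: sw; size_lia.
have fpos x : x \in xs -> 0 < (x - c) * (x - d).
  move=> hx; rewrite -(pmulr_rgt0 _ (rho0 x _)) ?inE ?hx ?orbT //.
  have := @peak x 1 1%N hx; rewrite size_poly1 hornerC !mul1r => <- //.
    by rewrite -riesz_wseq pos ?lagr_neq0 ?size_lagr.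
  by rewrite /N; size_lia.
split=> // [x|x hx|t ht]; last 1 first.
- rewrite -rieszXn exact ?size_polyXn; last by rewrite /N; size_lia.
  by apply: eq_bigr => y _; rewrite hornerXn.
- rewrite !inE => /or3P[/eqP->|/eqP->|hx].
  + by rewrite subrr mul0r ltW.
  + by rewrite subrr mulr0 ltW // (lt_trans c0).
  + split; last exact/ltW/fpos.
    rewrite -(pmulr_lge0 _ (fpos _ hx)) -(pmulr_rge0 _ (rho0 x _)) ?inE ?hx ?orbT //.
    rewrite -[X in _ * (X * _)]hornerX -(@peak x 'X 2%N) ?size_polyX //; last first.
      by rewrite /N; size_lia.
    by rewrite -riesz_wseq sq_Xgap // (leq_trans (size_lagr hx)).
- exact/ltW/rho0.
Qed.

Lemma rays_atoms_singular : ~ (sq_gt0 s m.+1 /\ sq_gt0 (wseq f s) m) ->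
  exists xs rho, rays_atoms c d s m.*2 xs rho.
Proof.
move=> h; have [spos|] := EM (sq_gt0 s m.+1); last exact: rays_atoms_hankel_singular.
by apply: rays_atoms_gap_singular => // h'; apply: h.
Qed.
End Rays.
End Gauss.

(** * Hankel forms and even extensions *)

Section HankelForms.
Variable R : realType.
Implicit Types (s : nat -> R) (p q w : {poly R}).

Definition hankel N s : 'M[R]_N := \matrix_(i, j) s (i + j)%N.

Lemma hankel_form N s (v : 'cV[R]_N) :
  (v^T *m hankel N s *m v) 0 0 = riesz s (rVpoly v^T ^+ 2).
Proof.
have -> : rVpoly v^T = \sum_(i < N) v i 0 *: 'X^i.
  rewrite {1}[v^T]row_sum_delta linear_sum /=; apply: eq_bigr => i _.
  by rewrite linearZ /= rVpoly_delta mxE.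
rewrite expr2 mulr_sumr linear_sum mxE; apply: eq_bigr => j _.
rewrite mxE mulr_suml [in RHS]mulr_suml linear_sum; apply: eq_bigr => i _.
by rewrite -[in RHS]scalerAr -[in RHS]scalerAl -exprD !linearZ /= rieszXn !mxE; ring.
Qed.

Lemma hankel_sym N s : hankel N s \is symmetricmx.
Proof.
by apply/is_hermitianmxP/matrixP => i j; rewrite expr0 scale1r !mxE addnC.
Qed.

Lemma psd_hankel N s : psdmx (hankel N s) <-> sq_ge0 s N.
Proof.
split=> [[_ h] p sp|h].
  have := h (poly_rV p)^T; rewrite hankel_form trmxK.
  by rewrite poly_rV_K.
by split=> [|v]; [exact: hankel_sym | rewrite hankel_form h ?size_poly].
Qed.

Lemma posdef_hankel N s : posdefmx (hankel N s) <-> sq_gt0 s N.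
Proof.
split=> [[_ h] p p0 sp|h].
  have := h (poly_rV p)^T; rewrite hankel_form trmxK poly_rV_K //; apply.
  apply: contra_neq p0 => /(congr1 trmx); rewrite trmxK trmx0 => e.
  by rewrite -(poly_rV_K sp) e linear0.
split=> [|v v0]; first exact: hankel_sym.
rewrite hankel_form h ?size_poly //; apply: contra_neq v0 => e.
by rewrite -[v]trmxK -[v^T]rVpolyK e linear0 trmx0.
Qed.

Lemma posdefmx_unit N (A : 'M[R]_N) : posdefmx A -> A \in unitmx.
Proof.
move=> [_ h]; rewrite unitmxE unitfE; apply/negP => /eqP/eqP/det0P[v v0 vA].
suff : false by []; have := h v^T; rewrite trmxK vA mul0mx mxE ltxx; apply.
by apply: contra_neq v0 => /(congr1 trmx); rewrite trmxK trmx0.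
Qed.

(** q = X^m - u, where the coefficients of u solve the Hankel system with right-hand side (s_m, ...,
    s_{2m-1}), a regular system by definiteness. *)
Lemma orthogonal_poly s m : sq_gt0 s m -> exists q : {poly R},
  [/\ q \is monic, size q = m.+1 &
    forall p, (size p <= m)%N -> riesz s (q * p) = 0].
Proof.
move=> /posdef_hankel/posdefmx_unit hu.
pose v := invmx (hankel m s) *m \col_(i < m) s (m + i)%N.
have hv : hankel m s *m v = \col_(i < m) s (m + i)%N by rewrite mulKVmx.
pose u := rVpoly v^T; have su : (size u <= m)%N by rewrite size_poly.
have sXu : size ('X^m - u) = m.+1.
  by rewrite size_polyDl size_polyXn // size_polyN ltnS.
exists ('X^m - u); split=> // [|p sp].
  by rewrite monicE lead_coefDl ?lead_coefXn // size_polyN size_polyXn ltnS.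
have qX (j : 'I_m) : riesz s (('X^m - u) * 'X^j) = 0.
  rewrite mulrBl linearB /= -exprD rieszXn.
  move/matrixP/(_ j 0): hv; rewrite !mxE => <-; apply/eqP; rewrite subr_eq0.
  apply/eqP; rewrite /u {1}[v^T]row_sum_delta linear_sum /= mulr_suml linear_sum.
  apply: eq_bigr => i _; rewrite linearZ /= rVpoly_delta -scalerAl -exprD.
  by rewrite linearZ /= rieszXn !mxE addnC mulrC.
rewrite -[p]coefK poly_def mulr_sumr linear_sum big1 // => i _.
by rewrite -scalerAr linearZ /= (qX (widen_ord sp i)) mulr0.
Qed.

Lemma riesz_congr s s' N p : (forall t, (t < N)%N -> s' t = s t) ->
  (size p <= N)%N -> riesz s' p = riesz s p.
Proof.
by move=> h sp; apply: eq_bigr => i _; rewrite h //; apply: leq_trans sp.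
Qed.

Lemma sq_ge0_congr s s' N n : (forall t, (t < N)%N -> s' t = s t) ->
  (n.*2.-1 <= N)%N -> sq_ge0 s n -> sq_ge0 s' n.
Proof.
move=> h nN h0 p sp; rewrite (riesz_congr h) ?h0 //.
exact: leq_trans (size_sqr_leq sp) nN.
Qed.

Lemma sq_gt0_congr s s' N n : (forall t, (t < N)%N -> s' t = s t) ->
  (n.*2.-1 <= N)%N -> sq_gt0 s n -> sq_gt0 s' n.
Proof.
move=> h nN h0 p p0 sp; rewrite (riesz_congr h) ?h0 //.
exact: leq_trans (size_sqr_leq sp) nN.
Qed.

Lemma wseq_congr w s s' N k : (forall t, (t < N)%N -> s' t = s t) ->
  (size w <= k.+1)%N ->
  forall t, (t < N - k)%N -> wseq w s' t = wseq w s t.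
Proof.
move=> h sw t tN; rewrite /wseq (riesz_congr h) // (leq_trans (size_polyMleq _ _)) //.
by rewrite size_polyXn; move: sw tN; move: (size w) => ?; lia.
Qed.

(** Write p = r + a q with r of degree below m. Orthogonality removes the cross term, so L(q^2), the
    Schur complement, is the only new condition. *)
Lemma sq_ge0_extend s m q : sq_ge0 s m -> q \is monic -> size q = m.+1 ->
  (forall p, (size p <= m)%N -> riesz s (q * p) = 0) ->
  0 <= riesz s (q ^+ 2) -> sq_ge0 s m.+1.
Proof.
move=> h mq sq qo q0 p sp; pose r := p - p`_m *: q.
have sr : (size r <= m)%N.
  apply/leq_sizeP => j mj; rewrite coefB coefZ.
  move: mj; rewrite leq_eqVlt => /orP[/eqP<-|mj].
    by move/monicP: mq; rewrite lead_coefE sq /= => ->; rewrite mulr1 subrr.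
  by rewrite [p`_j]nth_default ?[q`_j]nth_default ?sq ?mulr0 ?subr0 // (leq_trans sp).
have -> : p = r + p`_m *: q by rewrite subrK.
by rewrite riesz_sqDZ qo // mulr0 addr0 addr_ge0 ?h // mulr_ge0 // sqr_ge0.
Qed.

(** For the orthogonal polynomials q1 of degree m (weight 1) and q2 of degree m - 1 (weight f), the
    moment of index 2m enters L(q1^2) and L(f q2^2) with coefficient 1. Its least admissible value
    makes one of them 0. *)
Lemma even_extension c d s m : (0 < m)%N ->
  sq_gt0 s m -> sq_gt0 (wseq (gap_poly c d) s) m.-1 ->
  exists s', [/\ forall t, (t < m.*2)%N -> s' t = s t,
    sq_ge0 s' m.+1, sq_ge0 (wseq (gap_poly c d) s') m &
    ~ (sq_gt0 s' m.+1 /\ sq_gt0 (wseq (gap_poly c d) s') m)].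
Proof.
set f := gap_poly c d => m0 h1 h2.
have sf : size f = 3%N := size_gap_poly c d.
have [q1 [mq1 sq1 qo1]] := orthogonal_poly h1.
have [q2 [mq2 sq2 qo2]] := orthogonal_poly h2; rewrite prednK // in sq2.
pose S z t := s t + (t == m.*2)%:R * z.
have Ss z t : (t < m.*2)%N -> S z t = s t.
  by move=> tm; rewrite /S ltn_eqF // mul0r addr0.
have rS z p : p \is monic -> size p = m.*2.+1 -> riesz (S z) p = riesz s p + z.
  move=> mp sp; rewrite !(@rieszE _ _ _ m.*2.+1) ?sp // !big_ord_recr /=.
  have -> : \sum_(i < m.*2) p`_i * S z i = \sum_(i < m.*2) p`_i * s i.
    by apply: eq_bigr => i _; rewrite Ss.
  move/monicP: mp; rewrite lead_coefE sp /= => ->.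
  by rewrite /S eqxx !mul1r addrA.
have m1 : q1 ^+ 2 \is monic by rewrite monic_exp.
have m2 : f * q2 ^+ 2 \is monic by rewrite monicMl ?gap_poly_monic ?monic_exp.
have s1 : size (q1 ^+ 2)%R = m.*2.+1.
  by rewrite expr2 size_monicM ?monic_neq0 // sq1; lia.
have s2 : size (f * q2 ^+ 2)%R = m.*2.+1.
  rewrite size_monicM ?monic_neq0 ?gap_poly_monic ?monic_exp // sf.
  by rewrite expr2 size_monicM ?monic_neq0 // sq2; lia.
pose a := riesz s (q1 ^+ 2); pose b := riesz s (f * q2 ^+ 2).
(* The least z for which a + z and b + z are both nonnegative. *)
pose z := Num.max (- a) (- b).
have az : 0 <= a + z by rewrite addrC -[a]opprK subr_ge0 le_max lexx.
have bz : 0 <= b + z by rewrite addrC -[b]opprK subr_ge0 le_max lexx orbT.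
exists (S z); split; first exact: Ss.
- apply: (@sq_ge0_extend _ m q1) => //.
  + by apply: (sq_ge0_congr (Ss z)) (sq_gt0_ge0 h1); lia.
  + move=> p sp; rewrite (riesz_congr (Ss z)) ?qo1 //.
    rewrite (leq_trans (size_polyMleq _ _)) // sq1; move: sp.
    by move: (size p) => ?; lia.
  + by rewrite rS.
- rewrite -(prednK m0).
  have fS := @wseq_congr f s (S z) m.*2 2 (Ss z); rewrite sf in fS.
  apply: (@sq_ge0_extend _ m.-1 q2); rewrite ?prednK //.
  + by apply: (sq_ge0_congr (fS _)) (sq_gt0_ge0 h2) => //; lia.
  + move=> p sp; rewrite (riesz_congr (fS _)) ?qo2 //.
    rewrite (leq_trans (size_polyMleq _ _)) // sq2; move: sp.
    by move: (size p) => ?; lia.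
  + by rewrite riesz_wseq rS.
- move=> [/(_ q1) p1 /(_ q2) p2].
  have {}p1 : 0 < a + z by rewrite -rS //; apply: p1; rewrite ?monic_neq0 ?sq1.
  have {}p2 : 0 < b + z.
    by rewrite -rS // -riesz_wseq; apply: p2; rewrite ?monic_neq0 ?sq2.
  have [zE|zE] : z = - a \/ z = - b by rewrite /z; case: leP; auto.
    by move: p1; rewrite zE subrr ltxx.
  by move: p2; rewrite zE subrr ltxx.
Qed.

(** The extension is made singular in the form for 1 or for f. The forms for X and Xf involve only
    moments of index below 2m, so they survive a change of the last moment. *)
Lemma rays_atoms_exist c d s m : 0 < c -> c < d -> (0 < m)%N ->
  sq_ge0 (wseq 'X s) m -> sq_ge0 (wseq ('X * gap_poly c d) s) m.-1 ->
  (sq_gt0 s m /\ sq_gt0 (wseq (gap_poly c d) s) m.-1) \/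
  (exists s', [/\ forall t, (t < m.*2)%N -> s' t = s t,
    sq_ge0 s' m.+1 & sq_ge0 (wseq (gap_poly c d) s') m]) ->
  exists xs rho, rays_atoms c d s m.*2 xs rho.
Proof.
set f := gap_poly c d => c0 cd m0 hX hXf hs.
have sf : size f = 3%N := size_gap_poly c d.
have sXf : size ('X * f) = 4%N.
  by rewrite size_monicM ?monicX ?monic_neq0 ?gap_poly_monic // size_polyX sf.
have [s' [e h1 h2 h3]] : exists s', [/\ forall t, (t < m.*2)%N -> s' t = s t,
    sq_ge0 s' m.+1, sq_ge0 (wseq f s') m &
    ~ (sq_gt0 s' m.+1 /\ sq_gt0 (wseq f s') m)].
  case: hs => [[h1 h2]|[s' [e h1 h2]]]; first exact: even_extension.
  (* An extension with both forms definite is replaced by the minimal one; its restriction shows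
     that s satisfies the definiteness needed. *)
  have [[p1 p2]|h3] := EM (sq_gt0 s' m.+1 /\ sq_gt0 (wseq f s') m); last by exists s'.
  have e' t : (t < m.*2)%N -> s t = s' t by move/e.
  apply: even_extension => //.
    apply: (sq_gt0_congr e'); first by lia.
    by move=> p p0 sp; apply: p1; rewrite // ltnW.
  have fS := @wseq_congr f s' s m.*2 2 e'; rewrite sf in fS.
  apply: (sq_gt0_congr (fS _)) => //; first by lia.
  by move=> p p0 sp; apply: p2; rewrite // (leq_trans sp) // leq_pred.
have h4 : sq_ge0 (wseq 'X s') m.
  have fS := @wseq_congr 'X s s' m.*2 1 e; rewrite size_polyX in fS.
  by apply: (sq_ge0_congr (fS _)) hX => //; lia.
have h5 : sq_ge0 (wseq ('X * f) s') m.-1.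
  have fS := @wseq_congr ('X * f) s s' m.*2 3 e; rewrite sXf in fS.
  by apply: (sq_ge0_congr (fS _)) hXf => //; lia.
have [xs [rho [u x0 r0 H]]] := rays_atoms_singular c0 cd m0 h1 h4 h2 h5 h3.
by exists xs, rho; split=> // t tm; rewrite -e // H.
Qed.

End HankelForms.

(** * Recursion of finitely atomic sequences *)

Section Recursion.
Variables (R : realType) (S : nat -> R) (xs : seq R) (rho : R -> R).
Hypotheses (uxs : uniq xs) (rho0 : forall x, x \in xs -> 0 < rho x)
  (SE : forall t, S t = \sum_(x <- xs) rho x * x ^+ t).

Let riesz_S p : riesz S p = \sum_(x <- xs) rho x * p.[x].
Proof. by apply: (@riesz_atoms _ S xs rho (size p)) => // t _. Qed.

Let riesz_nodal p : riesz S (nodal xs * p) = 0.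
Proof.
rewrite riesz_S big_seq big1 // => x hx.
by move: hx; rewrite hornerM -horner_nodal_eq0 => /eqP ->; rewrite mul0r mulr0.
Qed.

(** A nonzero polynomial of degree below the number of atoms cannot vanish at all of them. *)
Lemma sq_gt0_atoms N : (N <= size xs)%N -> sq_gt0 S N.
Proof.
move=> hN p p0 sp; rewrite riesz_S lt_def; apply/andP; split; last first.
  rewrite big_seq sumr_ge0 // => x hx.
  by rewrite horner_exp mulr_ge0 ?sqr_ge0 // ltW // rho0.
rewrite big_seq psumr_neq0; last first.
  by move=> x hx; rewrite horner_exp mulr_ge0 ?sqr_ge0 // ltW // rho0.
apply: contraT => /hasPn h; have : (size xs < size p)%N.
  apply: max_poly_roots => //; apply/allP => x hx.
  have := h x hx; rewrite hx horner_exp pmulr_rgt0 ?rho0 // -leNgt => h'.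
  by rewrite /root -sqrf_eq0 eq_le h' sqr_ge0.
by rewrite ltnNge (leq_trans sp hN).
Qed.

Lemma hankel_atoms_unit N : (hankel N S \in unitmx) = (N <= size xs)%N.
Proof.
apply/idP/idP => [|/sq_gt0_atoms/posdef_hankel/posdefmx_unit//].
apply: contraLR; rewrite -ltnNge => hN.
(* The coefficient vector of [nodal xs] is a kernel vector. *)
rewrite unitmxE unitfE negbK; apply/det0P; exists (poly_rV (nodal xs)).
  apply/eqP => /(congr1 (@rVpoly _ _)); rewrite poly_rV_K ?size_nodal // linear0.
  exact/eqP/nodal_neq0.
apply/rowP => j; rewrite mxE mxE -[RHS](riesz_nodal 'X^j).
have e : nodal xs = \sum_(i < N) (nodal xs)`_i *: 'X^i.
  rewrite -poly_def; apply/polyP => i; rewrite coef_poly; case: ltnP => // h.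
  by rewrite nth_default // size_nodal (leq_trans hN).
rewrite [in RHS]e mulr_suml linear_sum; apply: eq_bigr => i _.
by rewrite -[in RHS]scalerAl -exprD linearZ /= rieszXn !mxE.
Qed.

(** L(X^j [nodal xs]) = 0, solved for its leading term. The separate n allows use with
    [hrank k delta], on which the type of the coefficients depends. *)
Lemma atoms_recursion n j : n = size xs ->
  S (n + j) = \sum_(i < n) - (nodal xs)`_i * S (j + i).
Proof.
move=> ->.
have := riesz_nodal 'X^j.
rewrite -{1}[nodal xs]coefK poly_def size_nodal mulr_suml linear_sum big_ord_recr /=.
have /monicP := nodal_monic xs; rewrite lead_coefE size_nodal /= => ->.
rewrite scale1r -exprD rieszXn addrC => /eqP; rewrite addr_eq0 => /eqP ->.
rewrite -sumrN; apply: eq_bigr => i _.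
by rewrite -scalerAl -exprD linearZ /= rieszXn mulNr addnC.
Qed.

Variables (k : nat) (delta : seq R).
Hypotheses (sk : (size xs <= k)%N) (sd : size delta = k.*2.+1)
  (dE : forall i, (i < k.*2.+1)%N -> delta`_i = S i).

Let hankel_delta N : (N <= k.+1)%N -> hankel_mx N delta = hankel N S.
Proof.
move=> hN; apply/matrixP => i j; rewrite !mxE dE //.
by have := ltn_ord i; have := ltn_ord j; lia.
Qed.

Lemma hrank_atoms : hrank k delta = size xs.
Proof.
rewrite /hrank hankel_delta // hankel_atoms_unit ifN -?ltnNge ?ltnS //.
have -> : iota 0 k.+1 = iota 0 (size xs) ++ size xs :: iota (size xs).+1 (k - size xs).
  by rewrite -[_ :: _]/(iota _ _.+1) -iotaD; congr iota; lia.
rewrite find_cat size_iota ifF; last first.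
  apply/hasPn => i; rewrite mem_iota /= => hi.
  by rewrite hankel_delta ?hankel_atoms_unit ?negbK //; lia.
by rewrite /= hankel_delta ?hankel_atoms_unit ?ltnn ?addn0 //; lia.
Qed.

(** The invertible system defining phi is solved by the negated lower coefficients of [nodal xs], so
    the recursion is that of the atoms. *)
Lemma rec_val_atoms (s : seq R) j : (size xs <= j)%N ->
  (forall i, (i < j)%N -> s`_i = S i) -> rec_val k delta s j = S j.
Proof.
move=> hj hs; have hr := hrank_atoms.
have cE : rec_coef k delta = \col_i - (nodal xs)`_i.
  rewrite /rec_coef; set A := hankel_mx _ _.
  have uA : A \in unitmx.
    by rewrite /A hankel_delta hr ?hankel_atoms_unit //; lia.
  rewrite -[RHS](mulKmx uA); congr (_ *m _); apply/colP => i.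
  have ri := ltn_ord i; rewrite /A !mxE dE; last by lia.
  rewrite (atoms_recursion _ hr); apply: eq_bigr => l _; rewrite !mxE mulrC dE //.
  by have := ltn_ord l; lia.
rewrite -hr in hj; rewrite /rec_val -[in RHS](subnKC hj) (atoms_recursion _ hr).
apply: eq_bigr => i _; rewrite cE mxE hs //.
by have := ltn_ord i; lia.
Qed.

Lemma pos_rec_gen_atoms : pos_rec_gen k delta.
Proof.
split.
- rewrite hankel_delta //; apply/psd_hankel => p _; rewrite riesz_S big_seq.
  by apply: sumr_ge0 => x hx; rewrite horner_exp mulr_ge0 ?sqr_ge0 // ltW // rho0.
- rewrite hankel_delta; last by rewrite hrank_atoms; lia.
  by apply/posdef_hankel; apply: sq_gt0_atoms; rewrite hrank_atoms.
- move=> _ j; rewrite hrank_atoms => /andP[j1 j2].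
  by rewrite rec_val_atoms ?dE // => i hi; rewrite dE //; lia.
Qed.

Lemma rec_extend_atoms t : (t < k.*2.+3)%N -> (rec_extend k delta)`_t = S t.
Proof.
have step s : (size xs <= size s)%N -> (forall i, (i < size s)%N -> s`_i = S i) ->
    forall i, (i < size (rec_step k delta s))%N -> (rec_step k delta s)`_i = S i.
  move=> s1 s2 i; rewrite /rec_step size_rcons nth_rcons ltnS leq_eqVlt.
  by case: ltngtP => //= [/s2|->] // _; rewrite rec_val_atoms.
move=> ht; apply: (step).
- by rewrite size_rcons sd; lia.
- apply: (step); first by rewrite sd; lia.
  by move=> i; rewrite sd; apply: dE.
- by rewrite !size_rcons sd.
Qed.

End Recursion.

(** * Localizing matrices *)

Section LocalizingMatrices.
Variable R : realType.
Implicit Types (s : nat -> R) (g : seq R) (c d : R).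

Lemma wseq1 s t : wseq 1 s t = s t.
Proof. by rewrite /wseq mul1r rieszXn. Qed.

Lemma wseqX s t : wseq 'X s t = s t.+1.
Proof. by rewrite /wseq -exprS rieszXn. Qed.

Lemma wseq_gap c d s t : wseq (gap_poly c d) s t =
  c * d * s t - (c + d) * s (t + 1)%N + s (t + 2)%N.
Proof.
rewrite /wseq; have -> : gap_poly c d * 'X^t =
    (c * d) *: 'X^t - (c + d) *: 'X^(t + 1) + 'X^(t + 2).
  by rewrite /gap_poly -!mul_polyC polyCM polyCD !exprD; ring.
by rewrite linearD linearB !linearZ /= !rieszXn.
Qed.

Lemma wseq_Xgap c d s t : wseq ('X * gap_poly c d) s t =
  c * d * s (t + 1)%N - (c + d) * s (t + 2)%N + s (t + 3)%N.
Proof.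
rewrite /wseq mulrAC mulrC -exprS -[LHS]/(wseq (gap_poly c d) s t.+1) wseq_gap.
by rewrite !(addn1, addn2, addn3).
Qed.

Section Moments.
Variables (N : nat) (g : seq R) (s : nat -> R).
Hypothesis gs : forall t, (t <= N)%N -> g`_t = s t.

(** The weight 1 is kept so that all four matrices have the form [hankel _ (wseq w s)]. *)
Lemma uHE : uH N g = hankel (N./2).+1 (wseq 1 s).
Proof.
apply/matrixP => i j; rewrite !mxE wseq1 gs //.
by have := ltn_ord i; have := ltn_ord j; lia.
Qed.

Lemma uH_gapE c d : uH_gap c d N g = hankel (N./2) (wseq (gap_poly c d) s).
Proof.
apply/matrixP => i j; have := ltn_ord i; have := ltn_ord j => hj hi.
by rewrite !mxE wseq_gap !gs //; lia.
Qed.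

Hypothesis oN : odd N.

Lemma uH_posE : uH_pos N g = hankel (N./2).+1 (wseq 'X s).
Proof.
apply/matrixP => i j; have := ltn_ord i; have := ltn_ord j => hj hi.
by rewrite !mxE wseqX gs ?addn1 //; lia.
Qed.

Lemma uH_pos_gapE c d :
  uH_pos_gap c d N g = hankel (N./2) (wseq ('X * gap_poly c d) s).
Proof.
apply/matrixP => i j; have := ltn_ord i; have := ltn_ord j => hj hi.
by rewrite !mxE wseq_Xgap !gs //; lia.
Qed.
End Moments.

(** * Moment conditions for finitely many atoms *)

Section Atoms.
Variables (c d : R) (n : nat) (g : seq R) (xs : seq R) (rho : R -> R).
Hypotheses (on : odd n) (sg : size g = (3 * n).+1)
  (atoms : rays_atoms c d (nth 0 g) (3 * n).+1 xs rho).

Let S t := \sum_(x <- xs) rho x * x ^+ t.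

Let gS t : (t <= 3 * n)%N -> g`_t = S t.
Proof. by case: atoms => _ _ _ h ht; rewrite h. Qed.

Let wseqS w t : wseq w S t = \sum_(x <- xs) rho x * w.[x] * x ^+ t.
Proof.
rewrite /wseq (@riesz_atoms _ S xs rho (size (w * 'X^t)%R)) //.
by apply: eq_bigr => x _; rewrite hornerM hornerXn mulrA.
Qed.

Definition nonneg_at (w : {poly R}) := forall x, x \in xs -> 0 <= w.[x].

Let sq_ge0_atoms w N : nonneg_at w -> sq_ge0 (wseq w S) N.
Proof.
move=> w0 p _; rewrite (@riesz_atoms _ _ xs (fun x => rho x * w.[x]) (size (p ^+ 2)%R)) //.
rewrite big_seq sumr_ge0 // => x hx; rewrite horner_exp.
by case: atoms => _ _ r0 _; rewrite mulr_ge0 ?sqr_ge0 // mulr_ge0 ?w0 ?r0.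
Qed.

(** The weighted measure has at most k atoms, since k + 1 of them would make the form definite;
    hence the recursion reproduces its moments. *)
Lemma determined_atoms w k delta : nonneg_at w -> size delta = k.*2.+1 ->
  (forall i, (i < k.*2.+1)%N -> delta`_i = wseq w S i) ->
  ~ sq_gt0 (wseq w S) k.+1 ->
  pos_rec_gen k delta /\
  forall t, (t < k.*2.+3)%N -> (rec_extend k delta)`_t = wseq w S t.
Proof.
move=> w0 sd dE hn; case: atoms => u _ r0 _.
(* Atoms of weighted mass 0 are dropped: the rank counts those of positive mass. *)
pose ys := [seq x <- xs | 0 < rho x * w.[x]].
have ySE t : wseq w S t = \sum_(x <- ys) (rho x * w.[x]) * x ^+ t.
  rewrite wseqS big_filter [RHS]big_mkcond [LHS]big_seq [RHS]big_seq.
  apply: eq_bigr => x hx; case: ltP => // h.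
  have -> : rho x * w.[x] = 0; last by rewrite mul0r.
  by apply/eqP; rewrite eq_le h mulr_ge0 ?w0 ?r0.
have y0 x : x \in ys -> 0 < rho x * w.[x] by rewrite mem_filter => /andP[].
have uy : uniq ys by rewrite filter_uniq.
have sk : (size ys <= k)%N.
  rewrite leqNgt; apply/negP => h; apply: hn.
  exact: (@sq_gt0_atoms _ _ ys (fun x => rho x * w.[x])).
by split; [apply: (pos_rec_gen_atoms uy y0 ySE) | move=> t; apply: (rec_extend_atoms uy y0 ySE)].
Qed.

Let nn1 : nonneg_at 1. Proof. by move=> x _; rewrite hornerC. Qed.
Let nnX : nonneg_at 'X.
Proof. by move=> x hx; rewrite hornerX; case: atoms => _ /(_ _ hx)[]. Qed.
Let nng : nonneg_at (gap_poly c d).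
Proof. by move=> x hx; rewrite horner_gap_poly; case: atoms => _ /(_ _ hx)[]. Qed.
Let nnXg : nonneg_at ('X * gap_poly c d).
Proof. by move=> x hx; rewrite hornerM mulr_ge0 ?nnX ?nng. Qed.

Lemma extension_cond_atoms k delta z : pos_rec_gen k delta ->
  z = S (3 * n + 1) -> extension_cond c d n g k delta z.
Proof.
move=> hd zE.
have gzS t : (t <= 3 * n + 1)%N -> (rcons g z)`_t = S t.
  rewrite nth_rcons sg => ht; case: ltngtP => [h|h|->]; first exact: gS.
    by lia.
  by rewrite zE addn1.
by split=> //; [rewrite (uHE gzS) | rewrite (uH_gapE gzS)];
  apply/psd_hankel; apply: sq_ge0_atoms.
Qed.

(** For the first weight w among 1, X, f, Xf whose form is not definite, the recursion yields the
    moment of the weighted measure that contains S (3n + 1) with coefficient 1; solving for it gives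
    the appended moment. *)
Lemma moment_conditions_of_atoms :
  [/\ psdmx (uH (3 * n - 1) g),
      psdmx (uH_pos (3 * n) g),
      psdmx (uH_gap c d (3 * n - 1) g) &
      psdmx (uH_pos_gap c d (3 * n) g)] /\
  ([/\ posdefmx (uH (3 * n - 1) g),
       posdefmx (uH_pos (3 * n) g),
       posdefmx (uH_gap c d (3 * n - 1) g) &
       posdefmx (uH_pos_gap c d (3 * n) g)]
   \/ [\/ ~ posdefmx (uH (3 * n - 1) g) /\
          (let k := ((3 * n - 1)./2)%N in
           let delta := delta_H n g in
           extension_cond c d n g k delta
             (rec_extend k delta)`_(3 * n + 1)),
          [/\ posdefmx (uH (3 * n - 1) g),
              ~ posdefmx (uH_pos (3 * n) g) &
              let k := ((3 * n - 1)./2)%N in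
              let delta := delta_pos n g in
              extension_cond c d n g k delta
                (rec_extend k delta)`_(3 * n)],
          [/\ posdefmx (uH (3 * n - 1) g),
              posdefmx (uH_pos (3 * n) g),
              ~ posdefmx (uH_gap c d (3 * n - 1) g) &
              let k := ((3 * n - 3)./2)%N in
              let delta := delta_gap c d n g in
              extension_cond c d n g k delta
                ((rec_extend k delta)`_(3 * n - 1)
                 + (c + d) * g`_(3 * n) - c * d * g`_(3 * n - 1))] |
          [/\ posdefmx (uH (3 * n - 1) g),
              posdefmx (uH_pos (3 * n) g),
              posdefmx (uH_gap c d (3 * n - 1) g),
              ~ posdefmx (uH_pos_gap c d (3 * n) g) &
              let k := ((3 * n - 3)./2)%N in
              let delta := delta_pos_gap c d n g in
              extension_cond c d n g k delta
                ((rec_extend k delta)`_(3 * n - 2)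
                 + (c + d) * g`_(3 * n) - c * d * g`_(3 * n - 1))]]).
Proof.
have o3 : odd (3 * n) by rewrite oddM.
have [m mE] : exists m, (3 * n = m.*2.+3)%N.
  by exists ((3 * n - 3)./2); have n0 := odd_gt0 on; lia.
have gS' t : (t <= 3 * n - 1)%N -> g`_t = S t by move=> ht; apply: gS; lia.
have e1 : ((3 * n - 1)./2 = m.+1)%N by lia.
have e2 : ((3 * n)./2 = m.+1)%N by lia.
have e3 : ((3 * n - 3)./2 = m)%N by lia.
rewrite (uHE gS') (uH_posE gS) // (uH_gapE gS') (uH_pos_gapE gS) //.
split; first by split; apply/psd_hankel/sq_ge0_atoms.
have [p1|n1] := EM (posdefmx (hankel ((3 * n - 1)./2).+1 (wseq 1 S))); last first.
  right; apply: Or41; split=> //=.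
  move: n1; rewrite posdef_hankel e1.
  move=> /(determined_atoms (delta := delta_H n g) nn1) h.
  have [||h1 h2] := h.
  - by rewrite size_mkseq; lia.
  - by move=> i hi; rewrite nth_mkseq ?wseq1 ?gS //; lia.
  - by apply: (extension_cond_atoms h1); rewrite h2 ?wseq1 //; lia.
have [p2|n2] := EM (posdefmx (hankel ((3 * n)./2).+1 (wseq 'X S))); last first.
  right; apply: Or42; split=> //=.
  move: n2; rewrite posdef_hankel e2 e1.
  move=> /(determined_atoms (delta := delta_pos n g) nnX) h.
  have [||h1 h2] := h.
  - by rewrite size_mkseq; lia.
  - by move=> i hi; rewrite nth_mkseq ?wseqX ?gS ?addn1 //; lia.
  - by apply: (extension_cond_atoms h1); rewrite h2 ?wseqX ?addn1 //; lia.
have [p3|n3] := EM (posdefmx (hankel (3 * n - 1)./2 (wseq (gap_poly c d) S))); last first.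
  right; apply: Or43; split=> //=.
  move: n3; rewrite posdef_hankel e1 e3.
  move=> /(determined_atoms (delta := delta_gap c d n g) nng) h.
  have [||h1 h2] := h.
  - by rewrite size_mkseq; lia.
  - by move=> i hi; rewrite nth_mkseq ?wseq_gap ?gS //; lia.
  - apply: (extension_cond_atoms h1); rewrite h2 ?wseq_gap ?gS; try lia.
    have -> : (3 * n - 1 + 1 = 3 * n)%N by lia.
    have -> : (3 * n - 1 + 2 = 3 * n + 1)%N by lia.
    by ring.
have [p4|n4] := EM (posdefmx (hankel (3 * n)./2 (wseq ('X * gap_poly c d) S))); last first.
  right; apply: Or44; split=> //=.
  move: n4; rewrite posdef_hankel e2 e3.
  move=> /(determined_atoms (delta := delta_pos_gap c d n g) nnXg) h.
  have [||h1 h2] := h.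
  - by rewrite size_mkseq; lia.
  - by move=> i hi; rewrite nth_mkseq ?wseq_Xgap ?gS //; lia.
  - apply: (extension_cond_atoms h1); rewrite h2 ?wseq_Xgap ?gS; try lia.
    have -> : (3 * n - 2 + 1 = 3 * n - 1)%N by lia.
    have -> : (3 * n - 2 + 2 = 3 * n)%N by lia.
    have -> : (3 * n - 2 + 3 = 3 * n + 1)%N by lia.
    by ring.
by left.
Qed.

End Atoms.

Lemma atoms_of_extension c d n g : odd n -> 0 < c -> c < d ->
  size g = (3 * n).+1 ->
  psdmx (uH_pos (3 * n) g) -> psdmx (uH_pos_gap c d (3 * n) g) ->
  (posdefmx (uH (3 * n - 1) g) /\ posdefmx (uH_gap c d (3 * n - 1) g)) \/
  (exists z, psdmx (uH (3 * n + 1) (rcons g z)) /\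
             psdmx (uH_gap c d (3 * n + 1) (rcons g z))) ->
  exists xs rho, rays_atoms c d (nth 0 g) (3 * n).+1 xs rho.
Proof.
move=> on c0 cd sg.
have o3 : odd (3 * n) by rewrite oddM.
have [m mE] : exists m, (3 * n = m.*2.+1)%N by exists ((3 * n)./2); lia.
have e1 : ((3 * n - 1)./2 = m)%N by lia.
have e2 : ((3 * n)./2 = m)%N by lia.
have e3 : ((3 * n + 1)./2 = m.+1)%N by lia.
(* With m + 1 in the role of m in [rays_atoms_exist], the given moments are exactly those of index
   below 2(m + 1). *)
have e4 : ((3 * n).+1 = m.+1.*2)%N by lia.
have w1 s N : sq_ge0 (wseq 1 s) N -> sq_ge0 s N.
  by move=> h p /h; rewrite riesz_wseq mul1r.
have w1' s N : sq_gt0 (wseq 1 s) N -> sq_gt0 s N.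
  by move=> h p p0 /(h _ p0); rewrite riesz_wseq mul1r.
rewrite (@uH_posE _ g (nth 0 g)) // (@uH_pos_gapE _ g (nth 0 g)) // !psd_hankel.
rewrite (@uHE _ g (nth 0 g)) // (@uH_gapE _ g (nth 0 g)) // !posdef_hankel.
rewrite e1 e2 e4 => hX hXf hs; apply: rays_atoms_exist => //.
case: hs => [[/w1' h1 h2]|[z]]; first by left.
rewrite (@uHE _ _ (nth 0 (rcons g z))) // (@uH_gapE _ _ (nth 0 (rcons g z))) //.
rewrite !psd_hankel e3 => -[/w1 h1 h2]; right; exists (nth 0 (rcons g z)); split=> // t ht.
by rewrite nth_rcons sg ifT //; lia.
Qed.

End LocalizingMatrices.

(** * Representing measures *)

Section Measures.
Variable R : realType.
Notation measR := {measure set (measurableTypeR R) -> \bar R}.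
Implicit Types (mu : measR) (E : set R).

(** The complement of the support is covered by the countably many null intervals with rational
    endpoints, which F enumerates. *)
Lemma negligible_notin_supp mu : mu.-negligible (~` measure_supp mu).
Proof.
pose F (k : nat) : set (measurableTypeR R) :=
  if @unpickle (rat * rat)%type k is Some ab then
    let I : set R := `]ratr ab.1, ratr ab.2[%classic in
    if mu I == 0%E then I else set0
  else set0.
suff sub : ~` measure_supp mu `<=` \bigcup_k F k.
  apply: (@negligibleS _ _ _ mu _ _ sub); apply: negligible_bigcup => k.
  rewrite /F; case: unpickle => [ab|] /=.
    by case: eqP => [h|_]; [exact/negligibleP | exact: negligible_set0].
  exact: negligible_set0.
move=> x /existsNP[U] /not_implyP[oU] /not_implyP[Ux] /negP; rewrite -leNgt => U0.
have /nbhs_ballP[e /= e0 eU] : nbhs x U by exact: open_nbhs_nbhs.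
have /rat_in_itvoo[a] : x - e < x by rewrite ltrBlDr ltrDl.
rewrite in_itv /= => /andP[a1 a2].
have /rat_in_itvoo[b] : x < x + e by rewrite ltrDl.
rewrite in_itv /= => /andP[b1 b2].
have [k kE] : exists k, @unpickle (rat * rat)%type k = Some (a, b).
  by exists (pickle (a, b)); apply: pickleK.
exists k; first exact: Logic.I.
rewrite /F kE /= ifT.
  by rewrite /= in_itv /= a2 b1.
rewrite eq_le measure_ge0 andbT (le_trans _ U0) // le_measure ?inE //.
  exact: open_measurable.
move=> y /=; rewrite in_itv /= => /andP[y1 y2]; apply: eU.
by rewrite /ball /= ltr_norml; apply/andP; split; lra.
Qed.

Lemma measurable_monomial t :
  measurable_fun [set: measurableTypeR R] (fun x : R => (x ^+ t)%:E).
Proof. exact/measurable_EFinP/measurable_funX. Qed.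

(** Almost everywhere x^t equals the finite sum of y^t times the indicator of {y}, over y in xs. *)
Lemma finitely_supported_moment mu (xs : seq R) t : uniq xs ->
  (mu setT < +oo)%E -> mu.-negligible (~` [set x | x \in xs]) ->
  mu.-integrable setT (fun x => (x ^+ t)%:E) /\
  (\int[mu]_x (x ^+ t)%:E = (\sum_(x <- xs) fine (mu [set x]) * x ^+ t)%:E)%E.
Proof.
move=> u fmu neg.
have fin x : mu [set x] \is a fin_num.
  rewrite ge0_fin_numE // (le_lt_trans _ fmu) // le_measure ?inE //.
pose ind (y x : measurableTypeR R) : \bar R := (\1_[set y] x)%:E.
have int_ind y : mu.-integrable setT (ind y).
  apply/integrableP; split.
    exact/measurable_EFinP/measurable_indic.
  under eq_integral do rewrite gee0_abs ?lee_fin //.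
  by rewrite integral_indic // setIT -ge0_fin_numE.
pose h (x : measurableTypeR R) := (\sum_(y <- xs) (y ^+ t)%:E * ind y x)%E.
have int_h : mu.-integrable setT h.
  by apply: integrable_sum => // y _; apply: integrableZl.
have ae_h : ae_eq mu setT (fun x => (x ^+ t)%:E) h.
  apply: (@negligibleS _ _ _ mu _ _ _ neg) => x /= hx hxs; apply: hx => _; rewrite /h.
  rewrite (bigD1_seq x) //= /ind indicE mem_set // mule1 big1 ?adde0 // => y yx.
  by rewrite indicE memNset ?mule0 // => /esym/eqP; rewrite (negPf yx).
have mt := measurable_monomial t.
have mh : measurable_fun setT h by exact: measurable_int int_h.
split.
  apply/integrableP; split=> //.
  case/integrableP: int_h => _.
  rewrite (@ae_eq_integral _ _ _ mu setT (fun x => `|(x ^+ t)%:E|%E)) //.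
  - exact: measurableT_comp.
  - exact: measurableT_comp.
  - by apply: filterS ae_h => x hx Tx; rewrite (hx Tx).
rewrite (ae_eq_integral h) // /h integral_sum // => [|y]; last exact: integrableZl.
rewrite -sumEFin; apply: eq_bigr => y _; rewrite integralZl // integral_indic //.
by rewrite setIT muleC EFinM fineK.
Qed.

Lemma representing_integral_poly mu E N (g : seq R) (p : {poly R}) :
  representing_measure E N g mu -> (size p <= N.+1)%N ->
  mu.-integrable setT (fun x => (p.[x])%:E) /\
  (\int[mu]_x (p.[x])%:E = (riesz (nth 0%R g) p)%:E)%E.
Proof.
move=> [_ hm] sp.
have hi (i : 'I_(size p)) : (i <= N)%N by rewrite -ltnS (leq_trans _ sp).
have pE x : (p.[x])%:E = (\sum_(i < size p) (p`_i)%:E * (x ^+ i)%:E)%E.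
  by rewrite horner_coef -sumEFin; apply: eq_bigr => i _; rewrite EFinM.
have ii (i : 'I_(size p)) :
    mu.-integrable setT (fun x : measurableTypeR R => ((p`_i)%:E * (x ^+ i)%:E)%E).
  by apply: integrableZl => //; case: (hm i (hi i)).
split.
  rewrite (_ : (fun x => _) = (fun x => \sum_(i < size p) (p`_i)%:E * (x ^+ i)%:E)%E).
    by apply: integrable_sum.
  exact/funext.
under eq_integral do rewrite pE.
rewrite integral_sum // -sumEFin; apply: eq_bigr => i _.
by case: (hm i (hi i)) => h1 h2; rewrite integralZl // h2 EFinM.
Qed.

(** Since p >= 0 on E and the integral of p is at most 0, p vanishes almost everywhere, so mu is
    carried by the roots of p in E, and the masses of these points serve as [rho]. *)
Lemma atoms_of_representing mu E N (g : seq R) (p : {poly R}) :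
  representing_measure E N g mu -> p != 0 -> (size p <= N.+1)%N ->
  (forall x, E x -> 0 <= p.[x]) -> riesz (nth 0 g) p <= 0 ->
  exists xs (rho : R -> R), [/\ uniq xs, forall x, x \in xs -> E x,
    forall x, x \in xs -> 0 <= rho x &
    forall t, (t <= N)%N -> g`_t = \sum_(x <- xs) rho x * x ^+ t].
Proof.
move=> rep p0 sp pE hp; have [int_p val_p] := representing_integral_poly rep sp.
have negE : mu.-negligible (~` E).
  by apply: (@negligibleS _ _ _ mu _ _ _ (negligible_notin_supp mu)); apply: subsetC; case: rep.
have mp := measurable_int mu int_p.
have mabs : measurable_fun setT (fun x : measurableTypeR R => `|(p.[x])%:E|%E).
  exact: measurableT_comp.
have ae_abs : ae_eq mu setT (fun x => `|(p.[x])%:E|%E) (fun x => (p.[x])%:E).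
  apply: (@negligibleS _ _ _ mu _ _ _ negE) => x /= hx Ex; apply: hx => _.
  by rewrite ger0_norm ?pE.
have : (\int[mu]_x `|(p.[x])%:E| = 0)%E.
  apply/eqP; rewrite eq_le integral_ge0 // andbT.
  by rewrite (ae_eq_integral (fun x : measurableTypeR R => (p.[x])%:E)) // val_p lee_fin.
move=> /(ae_eq_integral_abs mu measurableT mp) neg0.
pose xs := [seq x <- undup (polyrcf.rootsR p) | x \in E].
have ux : uniq xs by rewrite filter_uniq ?undup_uniq.
have negx : mu.-negligible (~` [set x | x \in xs]).
  apply: (@negligibleS _ _ _ mu _ _ _ (negligibleU neg0 negE)) => x /= hx.
  have [Ex|] := pselect (E x); last by right.
  left => h; apply: hx; rewrite mem_filter mem_undup mem_set //=.
  rewrite -(polyrcf.roots_on_rootsR p0) in_itv /=.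
  by have := h I; move=> [] /eqP.
have fmu : (mu setT < +oo)%E.
  case: rep => _ /(_ 0 (leq0n N)) [_].
  under eq_integral do rewrite expr0.
  by rewrite integral_cst // mul1e => ->; rewrite ltry.
exists xs, (fun x => fine (mu [set x])); split=> //.
- by move=> x; rewrite mem_filter => /andP[/set_mem].
- move=> t tN; have [_] := finitely_supported_moment t ux fmu negx.
  by case: rep => _ /(_ t tN) [_ ->] [].
Qed.

Lemma representing_of_atoms E N (g : seq R) (xs : seq R) (rho : R -> R) :
  closed E -> uniq xs -> (forall x, x \in xs -> E x) ->
  (forall x, x \in xs -> 0 <= rho x) ->
  (forall t, (t <= N)%N -> g`_t = \sum_(x <- xs) rho x * x ^+ t) ->
  exists mu, representing_measure E N g mu /\ finitely_atomic mu.
Proof.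
move=> cE ux xE r0 gE.
(* [finitely_atomic] asks for strictly positive masses. *)
pose ys := [seq x <- xs | 0 < rho x].
have uy : uniq ys by rewrite filter_uniq.
have y0 y : y \in ys -> 0 < rho y by rewrite mem_filter => /andP[].
have yE y : y \in ys -> E y by rewrite mem_filter => /andP[_ /xE].
pose pt k : measurableTypeR R := nth 0 ys k.
(* The norm supplies the nonnegativity of the scalar for every index k; at the points of [ys] it is
   the mass itself. *)
pose mu : measR :=
  msum (fun k => mscale (NngNum (normr_ge0 (rho (pt k)))) (dirac (pt k))) (size ys).
have muE A : mu A = (\sum_(k < size ys) (rho (pt k))%:E * \d_(pt k) A)%E.
  rewrite /mu /= /msum; apply: eq_bigr => k _; rewrite /mscale /=.
  by congr (_%:E * _)%E; exact/ger0_norm/ltW/y0/mem_nth.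
have muE' A : mu A = (\sum_(y <- ys) (rho y)%:E * \d_y A)%E.
  by rewrite muE (big_nth 0) big_mkord.
have mu1 y : y \in ys -> mu [set y] = (rho y)%:E.
  move=> hy; rewrite muE' (bigD1_seq y) //= diracE mem_set // mule1.
  rewrite big1 ?adde0 // => z zy; rewrite diracE memNset ?mule0 // => /eqP.
  by rewrite (negPf zy).
have mu0 A : (forall y, y \in ys -> ~ A y) -> mu A = 0%E.
  move=> h; rewrite muE' big_seq big1 // => y hy.
  by rewrite diracE memNset ?mule0 //; apply: h.
exists mu; split; last first.
  exists (size ys), (fun i : 'I_(size ys) => pt i), (fun i : 'I_(size ys) => rho (pt i)); split.
    by move=> i; rewrite y0 ?mem_nth.
  by move=> A _; apply: muE.
split=> [x hx|t tN].
  apply: contrapT => nE.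
  have := hx (~` E) (closed_openC cE) nE; rewrite mu0 ?ltxx // => y hy; apply.
  exact: yE.
have mys : measurable (~` [set x : measurableTypeR R | x \in ys]).
  apply: measurableC; rewrite (_ : [set x | x \in ys] = \big[setU/set0]_(y <- ys) [set y]).
    by apply: bigsetU_measurable.
  apply/seteqP; split=> x /=; rewrite -bigcup_seq /=.
    by move=> hx; exists x.
  by case=> y /= hy ->.
have neg : mu.-negligible (~` [set x | x \in ys]).
  by apply/negligibleP => //; apply: mu0 => y hy; apply.
have fmu : (mu setT < +oo)%E.
  rewrite muE'; under eq_bigr do rewrite diracT mule1.
  by rewrite sumEFin ltry.
have [i1 i2] := finitely_supported_moment t uy fmu neg; split=> //.
rewrite i2 gE // big_filter; congr (_%:E).
rewrite [LHS]big_mkcond [LHS]big_seq [RHS]big_seq /=; apply: eq_bigr => x hx.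
case: ltP => h; first by rewrite mu1 // mem_filter h.
by have -> : rho x = 0; [apply/eqP; rewrite eq_le h r0 | rewrite mul0r].
Qed.

Lemma two_raysE c d (x : R) : 0 < c -> c < d ->
  two_rays c d x <-> 0 <= x /\ 0 <= (x - c) * (x - d).
Proof.
move=> c0 cd; rewrite /two_rays /= !in_itv /= andbT; split.
  case=> [/andP[x0 xc]|dx]; split=> //.
  - by rewrite mulr_le0 // subr_le0 // (le_trans xc) // ltW.
  - by rewrite (le_trans _ dx) // ltW // (lt_trans c0).
  - by rewrite mulr_ge0 // subr_ge0 // (le_trans _ dx) // ltW.
move=> [x0 h]; have [xc|cx] := leP x c; first by left; rewrite x0.
by right; move: h; rewrite pmulr_rge0 ?subr_gt0 // subr_ge0.
Qed.

Lemma closed_two_rays (c d : R) : closed (two_rays c d).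
Proof. by apply: closedU; [exact: itv_closed | exact: rray_closed]. Qed.

End Measures.

(** If L(w q^2) <= 0 with q <> 0, then p = w q^2 is nonnegative on the rays and its roots carry the
    measure. Its degree is at most k + 2(n - 1), within the known moments. *)
Lemma atoms_of_not_posdef (R : realType) (c d : R) N (g : seq R) k (w : {poly R}) n
    (mu : {measure set (measurableTypeR R) -> \bar R}) :
  0 < c -> c < d -> representing_measure (two_rays c d) N g mu ->
  w != 0 -> (size w <= k.+1)%N -> (k + n.*2.-1 <= N.+1)%N ->
  (forall x, two_rays c d x -> 0 <= w.[x]) ->
  ~ sq_gt0 (wseq w (nth 0 g)) n ->
  exists xs rho, rays_atoms c d (nth 0 g) N.+1 xs rho.
Proof.
move=> c0 cd rep w0 sw kN wE /existsNP[q] /not_implyP[q0] /not_implyP[sq] /negP.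
rewrite -leNgt riesz_wseq => hq.
have [||||xs [rho [u xE r0 h]]] := atoms_of_representing (p := w * q ^+ 2) rep.
- by rewrite mulf_neq0 ?expf_neq0.
- by apply: leq_trans kN; have := size_mul_sqr_leq sw sq.
- by move=> x Ex; rewrite hornerM horner_exp mulr_ge0 ?sqr_ge0 ?wE.
- exact: hq.
- by exists xs, rho; split=> // x /xE /(two_raysE _ c0 cd).
Qed.

(** * The equivalence of the three conditions *)

Unset Implicit Arguments.

Theorem theorem5p6 (R : realType) (n : nat) (c d : R)
    (g : (3 * n).+1.-tuple R)
    (hn : (3 <= n)%N) (hodd : odd n) (hc : 0 < c) (hcd : c < d) :
  [<-> (* (1) *)
       exists mu : {measure set (measurableTypeR R) -> \bar R},
         representing_measure (two_rays c d) (3 * n) g mu;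
       (* (2) *)
       exists mu : {measure set (measurableTypeR R) -> \bar R},
         representing_measure (two_rays c d) (3 * n) g mu /\
         finitely_atomic mu;
       (* (3) *)
       [/\ psdmx (uH (3 * n - 1) g),
           psdmx (uH_pos (3 * n) g),
           psdmx (uH_gap c d (3 * n - 1) g) &
           psdmx (uH_pos_gap c d (3 * n) g)] /\
       ((* (a) *)
        [/\ posdefmx (uH (3 * n - 1) g),
            posdefmx (uH_pos (3 * n) g),
            posdefmx (uH_gap c d (3 * n - 1) g) &
            posdefmx (uH_pos_gap c d (3 * n) g)]
        (* (b), split by the first matrix failing to be positive definite *)
        \/ [\/ ~ posdefmx (uH (3 * n - 1) g) /\
               (let k := ((3 * n - 1)./2)%N in
                let delta := delta_H n g in
                extension_cond c d n g k delta
                  (rec_extend k delta)`_(3 * n + 1)),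
               [/\ posdefmx (uH (3 * n - 1) g),
                   ~ posdefmx (uH_pos (3 * n) g) &
                   let k := ((3 * n - 1)./2)%N in
                   let delta := delta_pos n g in
                   extension_cond c d n g k delta
                     (rec_extend k delta)`_(3 * n)],
               [/\ posdefmx (uH (3 * n - 1) g),
                   posdefmx (uH_pos (3 * n) g),
                   ~ posdefmx (uH_gap c d (3 * n - 1) g) &
                   let k := ((3 * n - 3)./2)%N in
                   let delta := delta_gap c d n g in
                   extension_cond c d n g k delta
                     ((rec_extend k delta)`_(3 * n - 1)
                      + (c + d) * g`_(3 * n) - c * d * g`_(3 * n - 1))] |
               [/\ posdefmx (uH (3 * n - 1) g),
                   posdefmx (uH_pos (3 * n) g),
                   posdefmx (uH_gap c d (3 * n - 1) g),
                   ~ posdefmx (uH_pos_gap c d (3 * n) g) &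
                   let k := ((3 * n - 3)./2)%N in
                   let delta := delta_pos_gap c d n g in
                   extension_cond c d n g k delta
                     ((rec_extend k delta)`_(3 * n - 2)
                      + (c + d) * g`_(3 * n) - c * d * g`_(3 * n - 1))]])].
Proof.
have o3 : odd (3 * n) by rewrite oddM.
have n0 := odd_gt0 hodd; have sg : size g = (3 * n).+1 := size_tuple g.
set P1 := exists mu, _; set P2 := exists mu, _; set P3 := _ /\ _.
have h21 : P2 -> P1 by move=> [mu [rep _]]; exists mu.
have h32 : P3 -> P2.
  move=> [[A B C D] hab].
  have [|xs [rho [u xE r0 h]]] := atoms_of_extension hodd hc hcd sg B D.
    case: hab => [[A' _ C' _]|]; first by left.
    (* Each case of (b) supplies an appended moment with semidefinite extended matrices. *)
    by case=> [[_ [_ ? ?]]|[_ _ [_ ? ?]]|[_ _ _ [_ ? ?]]|[_ _ _ _ [_ ? ?]]];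
      right; eexists; split; eassumption.
  have E x : x \in xs -> two_rays c d x by move/xE => hx; apply/two_raysE.
  exact: (representing_of_atoms (@closed_two_rays R c d) u E r0 h).
have h13 : P1 -> P3.
  move=> [mu rep].
  (* As soon as one form fails to be definite, the moments come from finitely many atoms on the
     rays, and these give the whole of (3). Here k bounds the degree of w. *)
  have atoms k (w : {poly R}) N : w != 0 -> (size w <= k.+1)%N -> (k + N.*2.-1 <= (3 * n).+1)%N ->
      (forall x, two_rays c d x -> 0 <= w.[x]) ->
      ~ posdefmx (hankel N (wseq w (nth 0 g))) -> P3.
    move=> w0 sw kN wE; rewrite posdef_hankel => hN.
    have [xs [rho hx]] := atoms_of_not_posdef hc hcd rep w0 sw kN wE hN.
    exact: (moment_conditions_of_atoms hodd sg hx).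
  have gap0 : gap_poly c d != 0 by rewrite monic_neq0 ?gap_poly_monic.
  have gapE x : two_rays c d x -> 0 <= (gap_poly c d).[x].
    by rewrite horner_gap_poly => /(two_raysE _ hc hcd)[].
  have XE x : two_rays c d x -> 0 <= 'X.[x].
    by rewrite hornerX => /(two_raysE _ hc hcd)[].
  have psd m (M : 'M[R]_m) : posdefmx M -> psdmx M.
    move=> [sM hM]; split=> // v; have [->|/hM/ltW//] := eqVneq v 0.
    by rewrite mulmx0 mxE.
  have [A|nA] := EM (posdefmx (uH (3 * n - 1) g)); last first.
    move: nA; rewrite (@uHE _ _ g (nth 0 g)) //.
    apply: (atoms 0%N); rewrite ?oner_neq0 ?size_poly1 //; first by lia.
    by move=> x _; rewrite hornerC.
  have [B|nB] := EM (posdefmx (uH_pos (3 * n) g)); last first.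
    move: nB; rewrite (@uH_posE _ _ g (nth 0 g)) //.
    by apply: (atoms 1%N); rewrite ?polyX_eq0 ?size_polyX //; lia.
  have [C|nC] := EM (posdefmx (uH_gap c d (3 * n - 1) g)); last first.
    move: nC; rewrite (@uH_gapE _ _ g (nth 0 g)) //.
    by apply: (atoms 2%N); rewrite ?size_gap_poly //; lia.
  have [D|nD] := EM (posdefmx (uH_pos_gap c d (3 * n) g)); last first.
    move: nD; rewrite (@uH_pos_gapE _ _ g (nth 0 g)) //.
    apply: (atoms 3%N).
    - by rewrite mulf_neq0 ?polyX_eq0.
    - by rewrite size_monicM ?monicX // size_polyX size_gap_poly.
    - by lia.
    - by move=> x Ex; rewrite hornerM mulr_ge0 ?XE ?gapE.
  by split; [split; apply: psd | left].
tfae.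
- by move/h13/h32.
- by move/h21/h13.
- by move/h32/h21.
Qed.
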